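(* Let $n\ge 2$. Let $S\subset\mathbb{R}^{n*}$ be a germ of strictly convex $C^1$-smooth hypersurface at a point $O_S$, and let $U\subset\mathbb{R}^n$ be a germ of strictly convex $C^1$-smooth hypersurface at a point $O_U$. Let $U$ and $S$ be level hypersurfaces of local $C^1$-smooth functions $F$ and $\widetilde F$, respectively, without critical points, and assume that the line through $O_S$ parallel to the vector $d_{O_U}F\in\mathbb{R}^{n*}$ is tangent to $S$ at $O_S$. Suppose that there exists a family of linear involutions $H_q:T_q\mathbb{R}^n\to T_q\mathbb{R}^n$, $q\in U$, with eigenvalues $\pm1$, fixing all vectors tangent to $U$ at $q$, such that for every $q\in U$ (close to $O_U$) and every $v_{\mathrm{in}}\in T_q\mathbb{R}^n$ close enough to the translation image of the vector $d_{O_S}\widetilde F$, the vector $v_{\mathrm{out}}$ assigned to $v_{\mathrm{in}}$ by the Finsler billiard map at $q$ is proportional to $H_q(v_{\mathrm{in}})$ with a positive coefficient. Then $S$ is (a part of) a quadric.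
   Context: $\mathbb{R}^{n*}$ is the dual of $\mathbb{R}^n$; $(\mathbb{R}^{n*})^*$ is canonically identified with $\mathbb{R}^n$, so $d_p\widetilde F$ for $p\in S$ is a vector of $\mathbb{R}^n$, while $d_qF$ is a vector of $\mathbb{R}^{n*}$; tangent spaces $T_q\mathbb{R}^n$ are identified with $\mathbb{R}^n$ by translation. A germ of strictly convex hypersurface is the germ of (an open piece of) the boundary of a strictly convex body, strictly convex meaning that every line meets the boundary in at most two points. Germs are represented by sufficiently small representatives; no regularity of $q\mapsto H_q$ is assumed. Each $H_q$ has eigenvalue $1$ with eigenspace the tangent hyperplane $T_qU$ and eigenvalue $-1$ with a one-dimensional eigenspace. Finsler billiard map $v_{\mathrm{in}}\mapsto v_{\mathrm{out}}$ at $q\in U$ close to $O_U$, for $v_{\mathrm{in}}$ close to $d_{O_S}\widetilde F$: let $p_1$ be the unique point of $S$ close to $O_S$ such that $d_{p_1}\widetilde F$ is a positive multiple of $v_{\mathrm{in}}$. Consider the line $\Lambda_q(p_1)=\{p_1+t\,d_qF\mid t\in\mathbb{R}\}$. If it meets $S$ in a second point $p_2$, put $v_{\mathrm{out}}=d_{p_2}\widetilde F\in(\mathbb{R}^{n*})^*=\mathbb{R}^n$; if it is tangent to $S$ at $p_1$, put $v_{\mathrm{out}}=v_{\mathrm{in}}$. A quadric is the zero set of a real polynomial of degree two; ''$S$ is a quadric'' means the germ $S$ is contained in a quadric. *)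

(* Defs.v *)
From HB Require Import structures.
From mathcomp Require Import all_boot all_order all_algebra.
From mathcomp Require Import all_classical all_reals all_analysis.
From mathcomp Require mpoly.
(* The notations of mpoly clash with those of all_analysis. *)
Import (canonicals, coercions) mpoly.

Set Implicit Arguments.
Unset Strict Implicit.
Unset Printing Implicit Defensive.

Import Order.TTheory GRing.Theory Num.Theory.
Import numFieldNormedType.Exports.

Local Open Scope classical_set_scope.
Local Open Scope ring_scope.

(* R^n is 'rV[R]_n and its dual is 'cV[R]_n, a covector w acting on a vector v
   by v *m w. More generally the dual of 'M_(m, k) is 'M_(k, m), paired by
   \tr (v *m w), so that the bidual of 'rV[R]_n is 'rV[R]_n itself.
   dmx f p is the differential of f at p seen as an element of the dual space;
   it is meaningful only where f is differentiable. *)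
Definition dmx (R : realType) (m k : nat) (f : 'M[R]_(m, k) -> R)
    (p : 'M[R]_(m, k)) : 'M[R]_(k, m) :=
  \matrix_(j < k, i < m) 'd f p (delta_mx i j).

Definition C1_submersion_near (R : realType) (m k : nat)
    (f : 'M[R]_(m, k) -> R) (O : 'M[R]_(m, k)) : Prop :=
  \forall p \near O,
    [/\ differentiable f p, {for p, continuous (dmx f)} & dmx f p != 0].

(* A germ of subset at O is given by any set S representing it; only the trace
   of S on small neighborhoods of O is used. *)
Definition level_germ (R : realType) (m k : nat)
    (S : set 'M[R]_(m, k)) (O : 'M[R]_(m, k)) (f : 'M[R]_(m, k) -> R) : Prop :=
  S O /\ \forall p \near O, S p <-> f p = f O.

Definition bdry (T : topologicalType) (K : set T) : set T :=
  closure K `\` interior K.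

Definition strictly_convex_body (R : realType) (m k : nat)
    (K : set 'M[R]_(m, k)) : Prop :=
  [/\ compact K, convex_set K, interior K !=set0 &
    forall (p v : 'M[R]_(m, k)) (t1 t2 t3 : R), v != 0 ->
      bdry K (p + t1 *: v) -> bdry K (p + t2 *: v) -> bdry K (p + t3 *: v) ->
      ~~ uniq [:: t1; t2; t3]].

Definition strictly_convex_C1_germ (R : realType) (m k : nat)
    (S : set 'M[R]_(m, k)) (O : 'M[R]_(m, k)) : Prop :=
  (exists f, C1_submersion_near f O /\ level_germ S O f) /\
  (exists K, [/\ strictly_convex_body K, bdry K O &
                \forall p \near O, S p <-> bdry K p]).

Definition tangent_hyperplane (R : realType) (m k : nat)
    (f : 'M[R]_(m, k) -> R) (p : 'M[R]_(m, k)) : set 'M[R]_(m, k) :=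
  [set v | 'd f p v = 0].

(* The matrix A acts on row vectors by v |-> v *m A. *)
Definition involution_fixing (R : realType) (n : nat)
    (T : set 'rV[R]_n) (A : 'M[R]_n) : Prop :=
  [/\ A *m A = 1%:M,
      forall v, (v <= eigenspace A 1)%MS <-> T v &
      \rank (eigenspace A (-1)) = 1%N].

(* The graph of the Finsler billiard map at q, computed on the representative
   S. When S is small, q is close to O_U and v_in is close to the differential
   of Ft at O_S, exactly one v_out satisfies this relation. *)
Definition finsler_billiard (R : realType) (n : nat) (S : set 'cV[R]_n)
    (F : 'rV[R]_n -> R) (Ft : 'cV[R]_n -> R)
    (q v_in v_out : 'rV[R]_n) : Prop :=
  exists p1 : 'cV[R]_n, [/\ S p1,
    exists2 c : R, 0 < c & dmx Ft p1 = c *: v_in &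
    (exists p2 : 'cV[R]_n, [/\ S p2, p2 != p1,
        exists t : R, p2 = p1 + t *: dmx F q & v_out = dmx Ft p2])
    \/ (tangent_hyperplane Ft p1 (dmx F q) /\ v_out = v_in)].

(* mmeasure mdeg, i.e. msize, is the total degree plus one. *)
Definition quadric (R : realType) (n : nat) (Q : set 'cV[R]_n) : Prop :=
  exists2 P : mpoly.mpoly n R, mpoly.mmeasure (@mpoly.mdeg n) P = 3%N &
    Q = [set p | mpoly.meval (fun i => p i 0) P = 0].

(* Main.v *)
Require Import Defs.
From HB Require Import structures.
From mathcomp Require Import all_boot all_order all_algebra.
From mathcomp Require Import all_classical all_reals all_analysis.
From mathcomp Require Import ring lra.
From mathcomp Require mpoly.
Import (canonicals, coercions) mpoly.

(** Write [nu p] for the normal of [S] at [p], pointing inside the convex body.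
   Minimising linear functionals over the body bounded by [U] shows that every
   covector close to [d F] at [O_U] is proportional to [d F] at some point of
   [U]; hence for every chord [p q] of [S] near [O_S] whose direction is close
   to that of [d F] there is a linear reflection of the dual space, negating
   [q - p], whose transpose sends normals to normals along all chords parallel
   to [p q]. Differentiating the midpoint of a moving chord, one sees that the
   corresponding affine reflection exchanges the germs of [S] at [p] and [q].

   For a triangle [p1 p2 p3] of such chords, composing the three reflections
   gives an affine map [M] fixing [p1] and preserving [S]. In the plane of the
   triangle [M] has determinant -1, multiplies the tangent by [- k] and the
   height above the tangent by [1 / k]. Applied twice this contradicts convexity
   unless [k = 1], and [k = 1] is the Ceva-type identity asserting that the
   normals can be rescaled to [N] with [dot (N p + N q) (p - q) = 0] on the three
   chords. Writing [p] in barycentric coordinates with respect to fixed points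
   [a_i] of [S], the combination of these relations with weights the coordinates
   eliminates [N p] and leaves a quadratic equation for [p]. *)

Set Implicit Arguments.
Unset Strict Implicit.
Unset Printing Implicit Defensive.

Import Order.TTheory GRing.Theory Num.Theory.
Import numFieldNormedType.Exports.

Local Open Scope classical_set_scope.
Local Open Scope ring_scope.

(** * The pairing between matrices and their dual *)

(** Arbitrary shapes let one set of lemmas serve both [U], among row vectors, and [S], among column
    vectors. *)
HB.lock Definition dot (R : realType) (m k : nat) (w : 'M[R]_(k, m))
  (v : 'M[R]_(m, k)) : R := \tr (w *m v).

Section Pairing.
Variables (R : realType) (m k : nat).
Implicit Types (v : 'M[R]_(m, k)) (w : 'M[R]_(k, m)).

Let dotT w v : dot w v = \tr (w *m v). Proof. by rewrite dot.unlock. Qed.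

Lemma dotE w v : dot w v = \sum_j \sum_i w j i * v i j.
Proof. by rewrite dotT /mxtrace; under eq_bigr do rewrite mxE. Qed.

Lemma dotDl w1 w2 v : dot (w1 + w2) v = dot w1 v + dot w2 v.
Proof. by rewrite !dotT mulmxDl mxtraceD. Qed.
Lemma dotDr w v1 v2 : dot w (v1 + v2) = dot w v1 + dot w v2.
Proof. by rewrite !dotT mulmxDr mxtraceD. Qed.
Lemma dotZl a w v : dot (a *: w) v = a * dot w v.
Proof. by rewrite !dotT -scalemxAl mxtraceZ. Qed.
Lemma dotZr a w v : dot w (a *: v) = a * dot w v.
Proof. by rewrite !dotT -scalemxAr mxtraceZ. Qed.
Lemma dotNl w v : dot (- w) v = - dot w v.
Proof. by rewrite -scaleN1r dotZl mulN1r. Qed.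
Lemma dotNr w v : dot w (- v) = - dot w v.
Proof. by rewrite -scaleN1r dotZr mulN1r. Qed.
Lemma dotBl w1 w2 v : dot (w1 - w2) v = dot w1 v - dot w2 v.
Proof. by rewrite dotDl dotNl. Qed.
Lemma dotBr w v1 v2 : dot w (v1 - v2) = dot w v1 - dot w v2.
Proof. by rewrite dotDr dotNr. Qed.
Lemma dot0r w : dot w 0 = 0.
Proof. by rewrite !dotT mulmx0 mxtrace0. Qed.
Lemma dot0l v : dot 0 v = 0.
Proof. by rewrite !dotT mul0mx mxtrace0. Qed.
Lemma dot_sumr (I : Type) (r : seq I) (P : pred I) w (V : I -> 'M[R]_(m, k)) :
  dot w (\sum_(i <- r | P i) V i) = \sum_(i <- r | P i) dot w (V i).
Proof.
by rewrite dotT mulmx_sumr raddf_sum; apply: eq_bigr => i _; rewrite dotT.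
Qed.

Definition dot_lin := (dotDl, dotDr, dotNl, dotNr, dotZl, dotZr).

Lemma dot_delta w i j : dot w (delta_mx i j) = w j i.
Proof.
rewrite dotE (bigD1 j) //= (bigD1 i) //= mxE !eqxx mulr1 !big1 ?addr0//.
- by move=> a aj; rewrite big1// => b _; rewrite mxE (negbTE aj) andbF mulr0.
- by move=> b bi; rewrite mxE (negbTE bi) mulr0.
Qed.

Lemma dot_neq0 w : w != 0 -> exists v, 0 < dot w v.
Proof.
move=> w0; have [[j i] /= wij|H] := pickP (fun x => w x.1 x.2 != 0); last first.
  case/eqP: w0; apply/matrixP => j i; rewrite mxE.
  by have /= := H (j, i) => /negbFE/eqP.
exists (w j i *: delta_mx i j); rewrite dotZr dot_delta.
by rewrite -expr2 exprn_even_gt0.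
Qed.

(** Every [d] becomes an element of the kernel of [w1], hence of [w2], after subtracting a multiple
    of one fixed [e] with [dot w1 e > 0]. *)
Lemma dot_proportional w1 w2 : w1 != 0 ->
  (forall v, dot w1 v = 0 -> dot w2 v = 0) -> exists c, w2 = c *: w1.
Proof.
move=> /dot_neq0[e e0] H; exists (dot w2 e / dot w1 e).
apply/matrixP => j i; rewrite mxE -!dot_delta.
set d := delta_mx i j.
have : dot w2 (d - (dot w1 d / dot w1 e) *: e) = 0.
  by apply: H; rewrite dotBr dotZr divfK ?subrr// gt_eqF.
rewrite dotBr dotZr => /eqP; rewrite subr_eq0 => /eqP ->.
by field; rewrite gt_eqF.
Qed.

Lemma diff_dot (f : 'M[R]_(m, k) -> R) p v : 'd f p v = dot (dmx f p) v.
Proof.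
rewrite dotE {1}[v]matrix_sum_delta linear_sum exchange_big/=.
under eq_bigr do rewrite linear_sum /=.
apply: eq_bigr => i _; apply: eq_bigr => j _.
by rewrite linearZ /= mxE mulrC.
Qed.

Lemma cvg_dot (T : Type) (F : set_system T) {FF : Filter F}
    (W : T -> 'M[R]_(k, m)) (V : T -> 'M[R]_(m, k)) w v :
  W @ F --> w -> V @ F --> v -> dot (W t) (V t) @[t --> F] --> dot w v.
Proof.
move=> Ww Vv; rewrite dotE.
under eq_fun do rewrite dotE.
apply: cvg_big => //; first exact: add_continuous.
move=> j _; apply: cvg_big => //; first exact: add_continuous.
move=> i _; apply: cvgM.
  exact: (cvg_comp _ _ Ww (@coord_continuous _ _ _ j i w)).
exact: (cvg_comp _ _ Vv (@coord_continuous _ _ _ i j v)).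
Qed.

Lemma near_dot_gt (T : topologicalType) (W : T -> 'M[R]_(k, m))
    (V : T -> 'M[R]_(m, k)) (x : T) a :
    {for x, continuous W} -> {for x, continuous V} -> a < dot (W x) (V x) ->
  \forall y \near x, a < dot (W y) (V y).
Proof. by move=> Wx Vx; apply: (cvgr_gt _ (cvg_dot Wx Vx)). Qed.

Lemma dot_le w v : `|dot w v| <= (k * m)%:R * (`|w| * `|v|).
Proof.
have le_coord p q (M : 'M[R]_(p, q)) i j : `|M i j| <= `|M|.
  have -> : `|M| = mx_norm M by [].
  by rewrite mx_normrE; apply: (@le_bigmax _ _ _ _ _ (i, j)).
have sumc q (c : R) : \sum_(i < q) c = q%:R * c.
  by rewrite sumr_const card_ord mulr_natl.
rewrite dotE natrM -mulrA -!sumc.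
apply: le_trans (ler_norm_sum _ _ _) _; apply: ler_sum => j _.
apply: le_trans (ler_norm_sum _ _ _) _; apply: ler_sum => i _.
by rewrite normrM ler_pM.
Qed.

End Pairing.

(** * Differential calculus along lines *)

Section Calculus.
Variables (R : realType) (m k : nat).
Local Notation V := 'M[R]_(m, k).
Implicit Types (f : V -> R) (p u e : V).

Lemma nbhs_addP (P : V -> Prop) p :
  (\forall q \near p, P q) <-> exists2 r, 0 < r & forall x, `|x| < r -> P (p + x).
Proof.
split=> [/nbhs_normP[r r0 Pr]|[r r0 Pr]].
  by exists r => // x xr; apply: Pr; rewrite /= opprD addNKr normrN.
apply/nbhs_normP; exists r => // q /= pq.
by rewrite -(subrKC p q); apply: Pr; rewrite distrC.
Qed.

Lemma near0_add (P : V -> Prop) p :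
  (\forall q \near p, P q) -> \forall x \near (0 : V), P (p + x).
Proof.
move=> /nbhs_addP[r r0 Pr]; apply/nbhs_addP; exists r => // x xr.
by rewrite add0r; exact: Pr.
Qed.

Lemma is_derive_line f p v (s : R) : differentiable f (p + s *: v) ->
  is_derive s 1 (fun r : R => f (p + r *: v)) (dot (dmx f (p + s *: v)) v).
Proof.
move=> df.
have E : (fun h : R => h^-1 *: (f (p + (h *: 1 + s) *: v) - f (p + s *: v))) =
         (fun h : R => h^-1 *: (f (h *: v + (p + s *: v)) - f (p + s *: v))).
  apply/funext => h; congr (_ *: (f _ - _)).
  by rewrite scalerDl addrCA /GRing.scale /= mulr1.
apply: DeriveDef.
  by rewrite /derivable /= E; exact: diff_derivable.
by rewrite /derive /= E -diff_dot -deriveE.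
Qed.

Lemma mean_value f p q :
    (forall t, 0 <= t <= 1 -> differentiable f (p + t *: (q - p))) ->
  exists2 t, 0 <= t <= 1 & f q - f p = dot (dmx f (p + t *: (q - p))) (q - p).
Proof.
move=> df; pose g (t : R) := f (p + t *: (q - p)).
have [||t /[!in_itv]/= t01 gE] := @MVT_segment R g
  (fun t => dot (dmx f (p + t *: (q - p))) (q - p)) 0 1 ler01.
- move=> t /[!in_itv]/= /andP[t0 t1]; apply: is_derive_line.
  by apply: df; rewrite !ltW.
- apply: derivable_within_continuous => t /[!in_itv]/= t01.
  by have [] := is_derive_line (df _ t01).
exists t => //; move: gE; rewrite /g scale1r scale0r addr0 subr0 mulr1.
by rewrite subrKC.
Qed.

Lemma cvg_line f p v : differentiable f p ->
  s^-1 * (f (p + s *: v) - f p) @[s --> 0^'+] --> dot (dmx f p) v.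
Proof.
move=> df; rewrite -diff_dot -deriveE//; apply: cvg_dnbhs_at_right.
have -> : (fun s => s^-1 * (f (p + s *: v) - f p)) =
          (fun h => h^-1 *: (f (h *: v + p) - f p)).
  by apply/funext => h; rewrite [p + _]addrC.
exact: diff_derivable.
Qed.

Lemma near_line_gt f p v : differentiable f p -> 0 < dot (dmx f p) v ->
  \forall s \near 0^'+, f p < f (p + s *: v).
Proof.
move=> df dv; near=> s.
have s0 : 0 < s by near: s; exact: nbhs_right_gt.
rewrite -subr_gt0 -(pmulr_rgt0 _ (_ : 0 < s^-1)) ?invr_gt0//.
by near: s; apply: (cvgr_gt _ (cvg_line df)).
Unshelve. all: by end_near. Qed.

Lemma near_line_lt f p v : differentiable f p -> dot (dmx f p) v < 0 ->
  \forall s \near 0^'+, f (p + s *: v) < f p.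
Proof.
move=> df dv; near=> s.
have s0 : 0 < s by near: s; exact: nbhs_right_gt.
rewrite -subr_lt0 -(pmulr_rlt0 _ (_ : 0 < s^-1)) ?invr_gt0//.
by near: s; apply: (cvgr_lt _ (cvg_line df)).
Unshelve. all: by end_near. Qed.

(** For small [s] the value of [f] is below [f p] at [tau = - rho] and above it at [tau = rho]; the
    intermediate value theorem in [tau] does the rest. This yields points of the level set leaving
    [p] almost along a tangent [u], inside the plane of [u] and a chosen transversal [e]. *)
Lemma tangent_point f p u e rho :
    (\forall q \near p, differentiable f q) ->
    dot (dmx f p) u = 0 -> 0 < dot (dmx f p) e -> 0 < rho ->
  \forall s \near 0^'+,
    exists2 tau, `|tau| <= rho & f (p + s *: (u + tau *: e)) = f p.
Proof.
move=> /nbhs_addP[r r0 df] du de rho0.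
have dfp : differentiable f p by rewrite -[p]addr0; apply: df; rewrite normr0.
have lo : dot (dmx f p) (u - rho *: e) < 0.
  by rewrite !dot_lin du add0r oppr_lt0 mulr_gt0.
have hi : 0 < dot (dmx f p) (u + rho *: e).
  by rewrite !dot_lin du add0r mulr_gt0.
have M0 : 0 < `|u| + rho * `|e| + 1.
  by rewrite ltr_wpDl// addr_ge0// mulr_ge0// ltW.
near=> s.
have s0 : 0 < s by near: s; exact: nbhs_right_gt.
have flo : f (p + s *: (u - rho *: e)) < f p by near: s; exact: near_line_lt.
have fhi : f p < f (p + s *: (u + rho *: e)) by near: s; exact: near_line_gt.
have sM : s * (`|u| + rho * `|e| + 1) < r.
  by rewrite -ltr_pdivlMr//; near: s; apply: nbhs_right_lt; rewrite divr_gt0.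
have sr tau : `|tau| <= rho -> `|s *: (u + tau *: e)| < r.
  move=> taur; apply: le_lt_trans sM; rewrite normrZ gtr0_norm// ler_pM2l//.
  rewrite (le_trans (ler_normD _ _))// normrZ -addrA lerD2l.
  by rewrite (le_trans (ler_wpM2r _ taur))// lerDl.
pose g (tau : R) := f ((p + s *: u) + tau *: (s *: e)).
have gE tau : g tau = f (p + s *: (u + tau *: e)).
  by rewrite /g scalerDr addrA !scalerA mulrC.
have [|||tau taur fE] := @IVT R g (- rho) rho (f p).
- by rewrite (le_trans _ (ltW rho0))// oppr_le0 ltW.
- apply: derivable_within_continuous => tau /[!in_itv]/= taur.
  have := @is_derive_line f (p + s *: u) (s *: e) tau; case => //.
  have -> : p + s *: u + tau *: (s *: e) = p + s *: (u + tau *: e).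
    by rewrite scalerDr addrA !scalerA mulrC.
  by apply/df/sr; rewrite ler_norml.
- by rewrite !gE scaleNr ge_min le_max (ltW flo) (ltW fhi) orbT.
by exists tau; [rewrite ler_norml; move: taur; rewrite in_itv | rewrite -gE].
Unshelve. all: by end_near. Qed.

End Calculus.

(** * Supporting hyperplanes of strictly convex bodies *)

Section Convexity.
Variables (R : realType) (m k : nat).
Local Notation V := 'M[R]_(m, k).
Implicit Types (f : V -> R) (K : set V) (p x y z : V).

Lemma convex_segment K x y t : convex_set K -> K x -> K y -> 0 <= t <= 1 ->
  K (x + t *: (y - x)).
Proof.
move=> cK Kx Ky /andP[t0 t1].
have := cK y x (Itv01 t0 t1); rewrite !inE => /(_ Ky Kx).
rewrite /conv /= /isConvexSpace.conv /=.
suff -> : x + t *: (y - x) = t *: y + (1 - t) *: x by [].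
by rewrite scalerBr scalerBl scale1r addrCA.
Qed.

Lemma interior_segment K x y t : convex_set K -> K x -> K° y -> 0 < t <= 1 ->
  K° (x + t *: (y - x)).
Proof.
move=> cK Kx /nbhs_addP[r r0 Ky] /andP[t0 t1].
apply/nbhs_addP; exists (t * r) => [|z zr]; first by rewrite mulr_gt0.
have -> : x + t *: (y - x) + z = x + t *: ((y + t^-1 *: z) - x).
  by rewrite (addrAC y) (scalerDr t (y - x)) scalerA divff ?gt_eqF// scale1r addrA.
apply: convex_segment => //; last by rewrite ltW.
by apply: Ky; rewrite normrZ gtr0_norm ?invr_gt0// mulrC ltr_pdivrMr// mulrC.
Qed.

Definition smooth_boundary_at f K p :=
  [/\ \forall q \near p, differentiable f q, dmx f p != 0 &
      \forall q \near p, f q = f p -> bdry K q].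

Lemma smooth_boundary_atP f K p : smooth_boundary_at f K p -> bdry K p.
Proof. by case=> _ _ /nbhs_singleton; exact. Qed.

Variable K : set V.
Hypothesis bodyK : strictly_convex_body K.

Lemma bdry_body x : bdry K x -> K x.
Proof.
case: bodyK => cK _ _ _ [clx _].
have /closure_id -> // : closed K by apply: compact_closed => //; exact: norm_hausdorff.
Qed.

(** If [y - p] were tangent, [tangent_point] would put a boundary point on a segment from [p] to
    some [y + tau *: e] still interior to [K]; but such a point is interior. *)
Lemma interior_not_tangent f p y : smooth_boundary_at f K p -> K° y ->
  dot (dmx f p) (y - p) != 0.
Proof.
move=> sp yK; have bp := smooth_boundary_atP sp.
case: sp => df /dot_neq0[e e0] bK; apply/eqP => dy.
have /nbhs_addP[r r0 yr] : nbhs y K° by exact: nbhs_interior.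
case: bodyK => _ convK _ _.
have rho0 : 0 < r / (`|e| + 1) by rewrite divr_gt0// ltr_wpDl.
have [d d0 bd] := (nbhs_addP _ _).1 bK.
have M0 : 0 < `|y - p| + r + 1 by rewrite ltr_wpDl// addr_ge0// ltW.
near (0 : R)^'+ => s.
have s0 : 0 < s by near: s; exact: nbhs_right_gt.
have s1 : s <= 1 by near: s; exact: nbhs_right_ltW.
have sM : s * (`|y - p| + r + 1) < d.
  by rewrite -ltr_pdivlMr//; near: s; apply: nbhs_right_lt; rewrite divr_gt0.
have [tau taur fE] : exists2 tau, `|tau| <= r / (`|e| + 1) &
    f (p + s *: (y - p + tau *: e)) = f p.
  by near: s; exact: tangent_point.
have te : `|tau *: e| < r.
  rewrite normrZ (le_lt_trans (ler_wpM2r _ taur))// -mulrA gtr_pMr//.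
  by rewrite mulrC ltr_pdivrMr ?ltr_wpDl// mul1r ltrDl.
have [_] : bdry K (p + s *: (y - p + tau *: e)).
  apply: bd => //; apply: le_lt_trans sM.
  rewrite normrZ gtr0_norm// ler_pM2l// (le_trans (ler_normD _ _))// -addrA lerD2l.
  by rewrite ler_wpDr// ltW.
apply; rewrite (addrAC y); apply: interior_segment => //; first exact: bdry_body.
  exact: yr.
by rewrite s0.
Unshelve. all: by end_near. Qed.

(** By [interior_not_tangent], [dot w (y - p)] is nonzero at interior points [y]. A negative value
    at [x] would force a zero at an interior point of the segment from [x] to [z]; a zero value
    would make [p], [x] and their midpoint three aligned boundary points. *)
Lemma strict_support f p (eps : R) z x : smooth_boundary_at f K p -> K° z ->
    0 < dot (eps *: dmx f p) (z - p) -> K x -> x != p ->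
  0 < dot (eps *: dmx f p) (x - p).
Proof.
set w := eps *: _ => sp zK dz Kx xp; have bp := smooth_boundary_atP sp.
have Kp := bdry_body bp; case: bodyK => _ convK _ sK.
have nt y : K° y -> dot w (y - p) != 0.
  move=> Ky; rewrite dotZl mulf_neq0 ?(interior_not_tangent sp)//.
  by apply: contraTneq dz => e0; rewrite /w e0 scale0r dot0l ltxx.
have [dx|//|dx] := ltrgtP (dot w (x - p)) 0.
- have a0 : 0 < dot w (z - p) - dot w (x - p).
    by rewrite subr_gt0 (lt_trans dx).
  pose s := - dot w (x - p) / (dot w (z - p) - dot w (x - p)).
  have s0 : 0 < s by rewrite divr_gt0// oppr_gt0.
  have s1 : s <= 1 by rewrite ler_pdivrMr// mul1r lerDr ltW.
  have : K° (x + s *: (z - x)) by apply: interior_segment => //; rewrite s0.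
  move=> /nt/eqP[].
  rewrite (_ : _ - p = (x - p) + s *: ((z - p) - (x - p))); last first.
    by rewrite opprB addrA subrK addrAC.
  by rewrite dotDr dotZr (dotBr _ (z - p)) /s divfK ?subrr// gt_eqF.
- have out y : dot w (y - p) = 0 -> K y -> bdry K y.
    move=> dy Ky; split; first exact: subset_closure.
    by move=> /nt/eqP; apply.
  have := sK p (x - p) 0 2^-1 1.
  rewrite subr_eq0 scale0r addr0 scale1r subrKC => /(_ xp bp).
  have h : dot w (p + 2^-1 *: (x - p) - p) = 0.
    by rewrite addrAC subrr add0r dotZr dx mulr0.
  have Km : K (p + 2^-1 *: (x - p)).
    by apply: convex_segment => //; rewrite invr_ge0 ler0n invf_le1 ?ler1n.
  move=> /(_ (out _ h Km) (out _ dx Kx)).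
  suff -> : uniq [:: 0; 2^-1; 1 : R] by [].
  rewrite /= !inE !negb_or (eq_sym 0 2^-1) (eq_sym 0 1) invr_eq0 pnatr_eq0 oner_eq0 /=.
  by rewrite andbT lt_eqF// invf_lt1 ?ltr1n.
Qed.

Lemma near_strict_support f p : C1_submersion_near f p ->
    (\forall q \near p, f q = f p -> bdry K q) ->
  exists2 eps : R, eps != 0 & \forall q \near p, f q = f p ->
    smooth_boundary_at f K q /\
    forall x, K x -> x != q -> 0 < dot (eps *: dmx f q) (x - q).
Proof.
move=> C1f bK.
have smooth : \forall q \near p, f q = f p -> smooth_boundary_at f K q.
  near=> q => fq; split.
  - suff : \forall x \near q, [/\ differentiable f x, {for x, continuous (dmx f)} & dmx f x != 0].
      by apply: filterS => x [].
    by near: q; exact: (near_join C1f).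
  - by have [] : [/\ differentiable f q, {for q, continuous (dmx f)} & dmx f q != 0] by near: q.
  - by rewrite fq; near: q; exact: (near_join bK).
have [_ cf _] := nbhs_singleton C1f.
case: (bodyK) => _ _ [z zK] _.
(* The sign of this constant turns the differential inwards: the pairing with [z - p] becomes a
   square at [p], and stays positive at nearby [q] by continuity. *)
exists (dot (dmx f p) (z - p)).
  by apply: interior_not_tangent => //; exact: (nbhs_singleton smooth).
near=> q => fq; have sq : smooth_boundary_at f K q by move: fq; near: q.
split=> // x Kx xq; apply: (strict_support sq zK _ Kx xq).
near: q; set a := dot (dmx f p) (z - p).
have ca : {for p, continuous (fun q : V => a *: dmx f q)}.
  exact: (continuous_comp cf (@scaler_continuous _ _ a _)).
have cz : {for p, continuous (fun q : V => (z : V) - q)}.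
  exact: (continuousB (@cst_continuous _ _ z p) cvg_id).
apply: (near_dot_gt ca cz); rewrite dotZl -expr2 exprn_even_gt0//=.
by apply: interior_not_tangent => //; exact: (nbhs_singleton smooth).
Unshelve. all: by end_near. Qed.

End Convexity.

(** * Surjectivity of the Gauss map *)

Section GaussMap.
Variables (R : realType) (m k : nat).
Local Notation V := 'M[R]_(m, k).
Implicit Types (f : V -> R) (K : set V) (p x y z : V).

Lemma dot_continuous (w : 'M[R]_(k, m)) : continuous (dot w : V -> R).
Proof. by move=> x; exact: (cvg_dot (@cst_continuous _ _ w x) cvg_id). Qed.

Lemma compact_dot_min K (w : 'M[R]_(k, m)) : compact K -> K !=set0 ->
  exists2 q, K q & forall x, K x -> dot w q <= dot w x.
Proof.
move=> cK K0; have [|q /[!inE] Kq qmin] := @compact_EVT_min _ R (dot w) K K0 cK.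
  by apply: continuous_subspaceT; exact: dot_continuous.
by exists q => // x Kx; apply: qmin; rewrite inE.
Qed.

(** If [w] decreased along [u], a point [p + s *: (u + tau *: e)] of the level set with small [tau]
    would lie in [K] and have a smaller value than the minimiser [p]. *)
Lemma tangent_le0 f K p (w : 'M[R]_(k, m)) u :
    strictly_convex_body K -> smooth_boundary_at f K p ->
    (forall x, K x -> dot w p <= dot w x) ->
  dot (dmx f p) u = 0 -> 0 <= dot w u.
Proof.
move=> bodyK [df /dot_neq0[e e0] bK] pmin du.
rewrite leNgt; apply/negP => wu.
have rho0 : 0 < - dot w u / (`|dot w e| + 1).
  by rewrite divr_gt0 ?oppr_gt0// ltr_wpDl.
have tp := tangent_point df du e0 rho0.
have [d d0 bd] := (nbhs_addP _ _).1 bK.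
set rho := - dot w u / _ in rho0 tp.
have M0 : 0 < `|u| + rho * `|e| + 1.
  by rewrite ltr_wpDl// addr_ge0// mulr_ge0// ltW.
near (0 : R)^'+ => s.
have s0 : 0 < s by near: s; exact: nbhs_right_gt.
have sM : s * (`|u| + rho * `|e| + 1) < d.
  by rewrite -ltr_pdivlMr//; near: s; apply: nbhs_right_lt; rewrite divr_gt0.
have [tau taur fE] : exists2 tau, `|tau| <= rho & f (p + s *: (u + tau *: e)) = f p.
  by near: s.
have : K (p + s *: (u + tau *: e)).
  apply: bdry_body => //; apply: bd => //; apply: le_lt_trans sM.
  rewrite normrZ gtr0_norm// ler_pM2l// (le_trans (ler_normD _ _))// -addrA lerD2l.
  by rewrite normrZ (le_trans (ler_wpM2r _ taur))// lerDl.
move=> /pmin; rewrite dotDr lerDl dotZr pmulr_rge0// dotDr dotZr leNgt => /negP; apply.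
have : `|tau * dot w e| < - dot w u.
  rewrite normrM (le_lt_trans (ler_wpM2r _ taur))// /rho -mulrA gtr_pMr ?oppr_gt0//.
  by rewrite mulrC ltr_pdivrMr ?ltr_wpDl// mul1r ltrDl.
by rewrite ltr_norml => /andP[_]; rewrite -subr_lt0 opprK addrC.
Unshelve. all: by end_near. Qed.

(** Strict support makes [O] the only minimiser of [eps *: dmx f O] over [K]. For [w] close to
    [dmx f O], a minimiser [q] of [eps *: w] exists by compactness and stays close to [O]; at [q]
    the covector [w] kills the tangent vectors. *)
Lemma gauss_map_onto f K O : strictly_convex_body K -> C1_submersion_near f O ->
    (\forall q \near O, bdry K q <-> f q = f O) ->
  forall N, nbhs O N -> \forall w \near dmx f O,
    exists q, [/\ N q, f q = f O & exists c, w = c *: dmx f q].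
Proof.
move=> bodyK C1f bKP N NO.
have bK : \forall q \near O, f q = f O -> bdry K q by apply: filterS bKP => q [].
have [eps eps0 sup] := near_strict_support bodyK C1f bK.
have [_ supO] := nbhs_singleton sup erefl.
have KO : K O by apply: bdry_body => //; exact: (nbhs_singleton bK).
case: (bodyK) => cK _ _ _.
set w0 := dmx f O in supO *.
have w00 : w0 != 0 by have [] := nbhs_singleton C1f.
pose G q := [/\ N q, bdry K q <-> f q = f O & f q = f O -> smooth_boundary_at f K q].
have GO : nbhs O G.
  near=> q; split; [by near: q|by near: q|].
  by move=> fq; have [] : smooth_boundary_at f K q /\
    forall x, K x -> x != q -> 0 < dot (eps *: dmx f q) (x - q) by move: fq; near: q.
(* Compactness gives a positive gap between the values outside [G] and the value 0 at [O]. *)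
have [m0 m0_gt0 far] : exists2 m0, 0 < m0 &
    forall x, K x -> ~ G x -> m0 <= dot (eps *: w0) (x - O).
  have cK' : compact (K `&` ~` G°).
    by apply: compact_closedI => //; apply: open_closedC; exact: open_interior.
  have [[x0 K'x0]|] := pselect (K `&` ~` G° !=set0); last first.
    move=> /set0P/negP/negPn/eqP K'0; exists 1 => // x Kx nGx.
    have : (K `&` ~` G°) x by split=> // /interior_subset.
    by rewrite K'0.
  have [q [Kq nGq] qmin] := compact_dot_min (eps *: w0) cK' (ex_intro _ x0 K'x0).
  exists (dot (eps *: w0) (q - O)).
    by apply: supO => //; apply: contra_not_neq nGq => ->; exact: GO.
  move=> x Kx nGx; rewrite !dotBr lerD2r; apply: qmin.
  by split=> // /interior_subset.
have [B B0 KB] : exists2 B, 0 < B & forall x, K x -> `|x - O| <= B.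
  have [M [_ MK]] := compact_bounded cK.
  exists (`|M| + 1 + `|O|); first by rewrite ltr_pwDl// ltr_wpDl.
  move=> x Kx; rewrite (le_trans (ler_normB _ _))// lerD2r.
  by apply: MK => //; rewrite (le_lt_trans (ler_norm _))// ltrDl.
(* A perturbation [h] of [w0] changes the values on [x - O] by at most [D] times the norm of [h], so
   below [m0 / D] the gap cannot be closed. *)
pose D := `|eps| * (k * m)%:R * B + 1.
have D0 : 0 < D by rewrite ltr_wpDl// mulr_ge0 ?mulr_ge0// ltW.
apply/nbhs_addP; exists (Num.min (m0 / D) `|w0|) => [|h].
  by rewrite lt_min divr_gt0// normr_gt0.
rewrite lt_min => /andP[hm hw]; set w := w0 + h.
have w_neq0 : w != 0.
  apply: contraTneq hw => /eqP; rewrite addr_eq0 => /eqP ->.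
  by rewrite normrN ltxx.
have [q Kq qmin] := compact_dot_min (eps *: w) cK (ex_intro _ O KO).
have [Nq bq sq] : G q.
  apply: contrapT => /(far _ Kq) mq.
  have := qmin _ KO; rewrite -subr_le0 -dotBr leNgt => /negP; apply.
  rewrite /w scalerDr dotDl -ltrBlDr sub0r.
  rewrite (lt_le_trans _ mq)// (le_lt_trans (ler_norm _))// normrN.
  rewrite dotZl normrM (le_lt_trans (ler_wpM2l _ (dot_le _ _)))//.
  rewrite (@le_lt_trans _ _ (D * `|h|))//; last by rewrite mulrC -ltr_pdivlMr.
  rewrite mulrDl mul1r (@le_trans _ _ (`|eps| * (k * m)%:R * B * `|h|)) ?lerDl//.
  rewrite -!mulrA ler_wpM2l// ler_wpM2l// mulrC ler_wpM2r//; exact: KB.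
(* A minimiser of a nonzero functional is not interior, so [q] is on the boundary. *)
have fq : f q = f O.
  apply/bq; split; first exact: subset_closure.
  move=> /nbhs_addP[r r0 Kr].
  have /dot_neq0[v v0] : eps *: w != 0 by rewrite scaler_eq0 negb_or eps0.
  have /qmin : K (q + (- (r / (`|v| + 1))) *: v).
    apply: Kr; rewrite normrZ normrN gtr0_norm ?divr_gt0 ?ltr_wpDl//.
    by rewrite -mulrA gtr_pMr// mulrC ltr_pdivrMr ?ltr_wpDl// mul1r ltrDl.
  rewrite dotDr lerDl dotZr mulNr oppr_ge0 leNgt => /negP; apply.
  by rewrite mulr_gt0// divr_gt0// ltr_wpDl.
exists q; split=> //.
have [_ nq _] := sq fq.
have [] := @dot_proportional _ _ _ (dmx f q) (eps *: w) nq.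
  move=> v dv; apply/eqP; rewrite eq_le; apply/andP; split.
    rewrite -oppr_ge0 -dotNr; apply: (tangent_le0 bodyK (sq fq) qmin).
    by rewrite dotNr dv oppr0.
  exact: (tangent_le0 bodyK (sq fq) qmin).
move=> c wE; exists (eps^-1 * c).
by rewrite -scalerA -wE scalerA mulVf// scale1r.
Unshelve. all: by end_near. Qed.

End GaussMap.

(** * Implicit functions and skew reflections preserving a level set *)

Section ImplicitGraph.
Variables (R : realType) (m k : nat).
Local Notation V := 'M[R]_(m, k).
Implicit Types (f : V -> R) (p x y z w : V).

(** Near [p] the derivative of [f] along [w] exceeds [c / 2], so each line along [w] has a unique
    root [T x], and mean values give the derivative of [T] along lines. The variable [x] runs over
    the whole space, which avoids choosing a complement of [w]. *)
Let implicit_graph_pos f p w (N : set V) : C1_submersion_near f p -> nbhs p N ->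
    0 < dot (dmx f p) w ->
  exists rho delta : R, exists T : V -> R, [/\ 0 < rho /\ 0 < delta,
    forall x, `|x| < rho ->
      [/\ `|T x| < delta, N (p + x + T x *: w) & f (p + x + T x *: w) = f p],
    forall x t, `|x| < rho -> `|t| < delta -> f (p + x + t *: w) = f p -> t = T x &
    forall x v s, `|x + s *: v| < rho ->
      let q := p + (x + s *: v) + T (x + s *: v) *: w in
      is_derive s 1 (fun r : R => T (x + r *: v)) (- dot (dmx f q) v / dot (dmx f q) w)].
Proof.
move=> C1f Np fw.
have [dfp cfp _] := nbhs_singleton C1f.
have [c cE] : exists c, c = dot (dmx f p) w by exists (dot (dmx f p) w).
have [M ME] : exists M, M = `|dmx f p| + 1 by exists (`|dmx f p| + 1).
rewrite -cE in fw.
have c2 : 0 < c / 2 by rewrite divr_gt0.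
pose G q := [/\ N q, differentiable f q, {for q, continuous (dmx f)},
  c / 2 < dot (dmx f q) w & `|dmx f q| < M].
have GP : nbhs p G.
  near=> q.
  have [? ? _] : [/\ differentiable f q, {for q, continuous (dmx f)} & dmx f q != 0] by near: q.
  split; [by near: q | by [] | by [] | |].
    near: q; apply: (near_dot_gt cfp (@cst_continuous _ _ w p)).
    by rewrite -cE ltr_pdivrMr// ltr_pMr// ltr1n.
  near: q; apply: (cvgr_lt _ (cvg_norm cfp)).
  by rewrite ME ltrDl.
have [r r0 Gr] := (nbhs_addP _ _).1 GP.
have mono z t : `|z| + `|t| * `|w| < r -> 0 < t -> f (p + z) < f (p + z + t *: w).
  have E : p + z + t *: w - (p + z) = t *: w by rewrite addrC addKr.
  move=> zt t0; have [|s /andP[s0 s1]] := @mean_value _ _ _ f (p + z) (p + z + t *: w).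
    move=> s /andP[s0 s1]; rewrite E -addrA.
    have [] // := Gr (z + s *: (t *: w)); rewrite (le_lt_trans (ler_normD _ _))//.
    rewrite (le_lt_trans _ zt)// lerD2l !normrZ ger0_norm// ler_piMl// mulr_ge0//.
  rewrite E -addrA => /eqP; rewrite subr_eq => /eqP ->.
  rewrite ltrDr dotZr pmulr_rgt0; last exact: t0.
  rewrite -(addrA p).
  have [|_ _ _ zw _] := Gr (z + s *: (t *: w)); last exact: lt_trans zw.
  rewrite (le_lt_trans (ler_normD _ _))//.
  by rewrite (le_lt_trans _ zt)// lerD2l !normrZ ger0_norm// ler_piMl// mulr_ge0//.
pose delta := r / 6 / (`|w| + 1).
have w1 : 0 < `|w| + 1 by rewrite ltr_wpDl.
have r2 : 0 < r / 2 by rewrite divr_gt0.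
have d0 : 0 < delta by rewrite divr_gt0// divr_gt0.
have dw : delta * `|w| < r / 6.
  by rewrite /delta -mulrA gtr_pMr ?divr_gt0// mulrC ltr_pdivrMr// mul1r ltrDl.
have Gxt x t : `|x| < r / 2 -> `|t| <= delta -> `|x + t *: w| < r.
  move=> xr td; have := ler_normD x (t *: w); have := ler_wpM2r (normr_ge0 w) td.
  rewrite normrZ; move: (`|x + _|) => ? ? ?; lra.
have hi : \forall q \near p + delta *: w, f p < f q.
  have [_ df _ _ _] : G (p + delta *: w).
    by apply: Gr; rewrite -[_ *: _]add0r Gxt ?normr0// gtr0_norm.
  apply: (cvgr_gt _ (differentiable_continuous df)).
  rewrite -{1}[p]addr0 -[p in ltRHS]addr0 mono// normr0 add0r gtr0_norm//.
  by lra.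
have lo : \forall q \near p - delta *: w, f q < f p.
  have [_ df _ _ _] : G (p - delta *: w).
    by apply: Gr; rewrite -scaleNr -[_ *: _]add0r Gxt ?normr0// normrN gtr0_norm.
  apply: (cvgr_lt _ (differentiable_continuous df)).
  rewrite -{2}[p](subrK (delta *: w)) mono// normrN normrZ gtr0_norm//.
  by lra.
have [r3 r30 hi3] := (nbhs_addP _ _).1 hi.
have [r4 r40 lo4] := (nbhs_addP _ _).1 lo.
pose rho := Num.min (r / 2) (Num.min r3 r4).
have rho0 : 0 < rho by rewrite !lt_min r2 r30 r40.
(* Nothing is asked of [t] beyond radius [rho], so that [T] is a total function. *)
have root x : exists t, `|x| < rho -> `|t| < delta /\ f (p + x + t *: w) = f p.
  have [|_] := boolP (`|x| < rho); last by exists 0.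
  rewrite !lt_min => /and3P[xr xr3 xr4].
  have fhi : f p < f (p + x + delta *: w) by rewrite addrAC; exact: hi3.
  have flo : f (p + x + (- delta) *: w) < f p by rewrite scaleNr addrAC; exact: lo4.
  have [|||t td ft] := @IVT R (fun t => f (p + x + t *: w)) (- delta) delta (f p).
  - by rewrite (le_trans _ (ltW d0))// oppr_le0 ltW.
  - apply: derivable_within_continuous => t /[!in_itv]/= td.
    have := @is_derive_line _ _ _ f (p + x) w t; case => //.
    by rewrite -addrA; have [] // := Gr (x + t *: w); rewrite Gxt// ler_norml.
  - by rewrite ge_min le_max (ltW flo) (ltW fhi) orbT.
  exists t => _; split=> //; move: td; rewrite in_itv/= ltr_norml => /andP[t1 t2].
  rewrite !lt_neqAle t1 t2 !andbT; apply/andP; split.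
    by apply: contraTneq flo => ->; rewrite ft ltxx.
  by apply: contraTneq fhi => <-; rewrite ft ltxx.
have [T TP] := choice root.
have uniq_root x t : `|x| < rho -> `|t| < delta -> f (p + x + t *: w) = f p -> t = T x.
  move=> xr td ft; have [Td fT] := TP _ xr.
  have xr2 : `|x| < r / 2 by move: xr; rewrite lt_min => /andP[].
  have H a b : `|a| < delta -> `|b| < delta -> a < b ->
      f (p + x + a *: w) < f (p + x + b *: w).
    move=> ad bd ab.
    have -> : p + x + b *: w = p + (x + a *: w) + (b - a) *: w.
      by rewrite scalerBl !addrA (addrAC _ (b *: w)) addrK.
    rewrite -addrA; apply: mono; last by rewrite subr_gt0.
    have := ler_normD x (a *: w); rewrite normrZ.
    have := ler_wpM2r (normr_ge0 w) (ltW ad).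
    have : `|b - a| * `|w| <= delta * `|w| + delta * `|w|.
      rewrite -mulrDl ler_wpM2r// (le_trans (ler_normB _ _))// lerD// ltW//.
    lra.
  have [tT|Tt|//] := ltgtP t (T x).
    by have := H _ _ td Td tT; rewrite ft fT ltxx.
  by have := H _ _ Td td Tt; rewrite ft fT ltxx.
have Tr x : `|x| < rho -> `|x + T x *: w| < r.
  move=> xr; have [Td _] := TP _ xr; apply: Gxt; last exact: ltW.
  by move: xr; rewrite lt_min => /andP[].
exists rho, delta, T; split=> //.
  move=> x xr; have [Td fT] := TP x xr; split=> //.
  by rewrite -addrA; have [] := Gr _ (Tr _ xr).
pose Q x := p + x + T x *: w.
have QE x : Q x = p + (x + T x *: w) by rewrite /Q addrA.
have QB x y : Q y - Q x = (y + T y *: w) - (x + T x *: w).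
  by rewrite !QE opprD addrACA subrr add0r.
have QBT x y : Q y - Q x = (y - x) + (T y - T x) *: w.
  by rewrite QB opprD addrACA scalerBl.
(* The mean value theorem between two points of the graph. The intermediate [z] may leave the level
   set, but it is no farther from [Q x] than [Q y] is. *)
have slope x y : `|x| < rho -> `|y| < rho -> exists z, [/\ `|z - Q x| <= `|Q y - Q x|,
    G z & T y - T x = - dot (dmx f z) (y - x) / dot (dmx f z) w].
  move=> xr yr; have [_ fx] := TP _ xr; have [_ fy] := TP _ yr.
  have segr s : 0 <= s <= 1 -> G (Q x + s *: (Q y - Q x)).
    move=> /andP[s0 s1]; have -> : Q x + s *: (Q y - Q x) =
        p + ((1 - s) *: (x + T x *: w) + s *: (y + T y *: w)).
      rewrite QB QE scalerBl scale1r scalerBr -addrA; congr (p + _).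
      by rewrite [RHS]addrAC addrA.
    apply: Gr; rewrite (le_lt_trans (ler_normD _ _))// !normrZ ger0_norm ?subr_ge0//.
    rewrite (ger0_norm s0); have := Tr _ xr; have := Tr _ yr.
    move: (`|y + _|) (`|x + _|) => b a br ar.
    have s1' : 0 <= 1 - s by rewrite subr_ge0.
    have [/(ler_wpM2l s1')|/ltW/(ler_wpM2l s0)] := lerP a b; lra.
  have [|s s01] := @mean_value _ _ _ f (Q x) (Q y).
    by move=> s /segr[].
  have [_ _ _ zw _] := segr _ s01.
  rewrite fx fy subrr => zE; exists (Q x + s *: (Q y - Q x)); split; last 1 first.
  - have zw0 : dot (dmx f (Q x + s *: (Q y - Q x))) w != 0 by rewrite gt_eqF// (lt_trans _ zw).
    apply: (mulIf zw0); rewrite divfK//; apply/eqP; rewrite -addr_eq0 addrC.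
    by rewrite -dotZr -dotDr -QBT -zE.
  - rewrite addrAC subrr add0r normrZ; case/andP: s01 => s0 s1.
    by rewrite ger0_norm// ler_piMl.
  - exact: segr.
(* A Lipschitz constant of [Q]: the slope of [T] has numerator at most [(k * m)%:R * M] times the
   norm of [y - x], and denominator above [c / 2]. *)
pose C := 1 + (k * m)%:R * M / (c / 2) * `|w|.
have M0 : 0 < M by rewrite ME ltr_wpDl.
have C0 : 0 < C by rewrite ltr_pwDl// mulr_ge0// divr_ge0 ?mulr_ge0// ltW.
have lip x y : `|x| < rho -> `|y| < rho -> `|Q y - Q x| <= C * `|y - x|.
  move=> xr yr; have [z [_ [_ _ _ zw zM] TE]] := slope _ _ xr yr.
  rewrite QBT (le_trans (ler_normD _ _))// /C mulrDl mul1r lerD2l normrZ [leRHS]mulrAC.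
  rewrite ler_wpM2r// TE normrM normrN normfV.
  have zw0 : 0 < dot (dmx f z) w by exact: lt_trans zw.
  rewrite (gtr0_norm zw0) ler_pdivrMr// (le_trans (dot_le _ _))//.
  apply: (@le_trans _ _ ((k * m)%:R * M * `|y - x|)).
    by rewrite mulrA ler_wpM2r// ler_wpM2l// ltW.
  rewrite (mulrAC _ (c / 2)^-1) -[leRHS]mulrA ler_peMr ?mulr_ge0 ?(ltW M0)//.
  by rewrite mulrC ler_pdivlMr// mul1r ltW.
move=> x v s xs; set y := x + s *: v => q.
have qE : q = Q y by [].
have [_ _ cq qw _] : G (Q y) by rewrite /Q -addrA; apply: Gr; exact: Tr.
pose phi z := - dot (dmx f z) v / dot (dmx f z) w.
have qw0 : dot (dmx f q) w != 0 by rewrite gt_eqF// (lt_trans _ qw).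
have phic : phi z @[z --> q] --> phi q.
  exact: (cvgM (cvgN (cvg_dot cq (@cst_continuous _ _ v q)))
               (cvgV qw0 (cvg_dot cq (@cst_continuous _ _ w q)))).
have quot : h^-1 *: (T (x + (h *: (1 : R) + s) *: v) - T y) @[h --> 0^'] --> phi q.
  apply/pseudometric_normed_Zmodule.cvgrPdist_lt => e e0.
  have [d d_gt0 phid] := (nbhs_addP _ _).1
    ((pseudometric_normed_Zmodule.cvgrPdist_lt _ _).1 phic _ e0).
  have v1 : 0 < C * (`|v| + 1) by rewrite mulr_gt0// ltr_wpDl.
  have v2 : 0 < `|v| + 1 by rewrite ltr_wpDl.
  have xs0 : 0 < rho - `|y| by rewrite subr_gt0.
  near=> h.
  have h0 : h != 0 by near: h; exact: nbhs_dnbhs_neq.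
  have hd : `|h| * (C * (`|v| + 1)) < d.
    by rewrite -ltr_pdivlMr//; near: h; apply: dnbhs0_lt; rewrite divr_gt0.
  have hr : `|h| * (`|v| + 1) < rho - `|y|.
    by rewrite -ltr_pdivlMr//; near: h; apply: dnbhs0_lt; rewrite divr_gt0.
  have -> : x + (h *: (1 : R) + s) *: v = y + h *: v.
    have -> : h *: (1 : R) = h by exact: mulr1.
    by rewrite scalerDl [h *: v + _]addrC addrA.
  have yr : `|y + h *: v| < rho.
    rewrite (le_lt_trans (ler_normD _ _))// addrC -ltrBrDr (le_lt_trans _ hr)//.
    by rewrite normrZ ler_wpM2l// lerDl.
  have yh : y + h *: v - y = h *: v by rewrite addrC addKr.
  have [z [zq [_ _ _ zw _]]] := slope _ _ xs yr.
  rewrite yh dotZr -mulrN -mulrA => ->.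
  rewrite -[_ *: _]/(_ * _) mulKf//.
  rewrite -(subrKC q z); apply: phid; rewrite qE (le_lt_trans zq)//.
  rewrite (le_lt_trans (lip _ _ xs yr))// yh normrZ.
  rewrite (le_lt_trans _ hd)// mulrCA ler_wpM2l// ler_wpM2l ?lerDl// ltW//.
apply: DeriveDef; first by apply/cvg_ex; exists (phi q); exact: quot.
by apply: (cvg_lim _ quot).
Unshelve. all: by end_near. Qed.

(** Replacing [w] by [a *: w], with [a] its pairing with the differential, makes that pairing a
    square; [T] and [delta] are rescaled accordingly. *)
Lemma implicit_graph f p w (N : set V) : C1_submersion_near f p -> nbhs p N ->
    dot (dmx f p) w != 0 ->
  exists rho delta : R, exists T : V -> R, [/\ 0 < rho /\ 0 < delta,
    forall x, `|x| < rho ->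
      [/\ `|T x| < delta, N (p + x + T x *: w) & f (p + x + T x *: w) = f p],
    forall x t, `|x| < rho -> `|t| < delta -> f (p + x + t *: w) = f p -> t = T x &
    forall x v s, `|x + s *: v| < rho ->
      let q := p + (x + s *: v) + T (x + s *: v) *: w in
      is_derive s 1 (fun r : R => T (x + r *: v)) (- dot (dmx f q) v / dot (dmx f q) w)].
Proof.
move=> C1f Np fw0.
have [a aE a0] : exists2 a, a = dot (dmx f p) w & a != 0 by exists (dot (dmx f p) w).
have [|rho [delta [T [[rho0 d0] T1 T2 T3]]]] := @implicit_graph_pos f p (a *: w) N C1f Np.
  by rewrite dotZr -aE -expr2 exprn_even_gt0.
exists rho, (`|a| * delta), (fun x => a * T x).
have a1 : 0 < `|a| by rewrite normr_gt0.
split; first by rewrite mulr_gt0.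
- move=> x /T1; rewrite !scalerA => -[Td NT fT].
  by split; rewrite // ?normrM ?ltr_pM2l// mulrC.
- move=> x t xr td ft; have E : t / a = T x.
    apply: T2 => //; last by rewrite scalerA divfK.
    by rewrite normrM normfV ltr_pdivrMr// mulrC.
  by rewrite -E mulrC divfK.
move=> x v s xr q.
have dT : is_derive s 1 (fun r : R => T (x + r *: v))
    (- dot (dmx f q) v / (a * dot (dmx f q) w)).
  by have := T3 x v s xr; rewrite /= scalerA (mulrC (T _)) dotZr.
have -> : - dot (dmx f q) v / dot (dmx f q) w =
    a *: (- dot (dmx f q) v / (a * dot (dmx f q) w)).
  by rewrite -[_ *: _]/(_ * _) invfM mulrCA mulVKf.
exact: is_deriveZ.
Qed.

End ImplicitGraph.

(** * Transport of the level set along parallel chords *)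

Section Transport.
Variables (R : realType) (m k : nat).
Local Notation V := 'M[R]_(m, k).
Local Notation W := 'M[R]_(k, m).
Implicit Types (f : V -> R) (p x y z w : V) (eta nu : W).

(* For [dot eta w = -2], [skew_reflection eta w] is the linear involution
   mapping [w] to [- w] and fixing the kernel of [eta]. *)
Definition skew_reflection eta w x : V := x + dot eta x *: w.

(** The transpose of [skew_reflection eta w]. For [dot eta w = -2] it negates [eta] and fixes the
    covectors vanishing on [w]. *)
Definition skew_reflection_dual eta w nu : W := nu + dot nu w *: eta.

Lemma skew_reflection_adj eta w nu x :
  dot nu (skew_reflection eta w x) = dot (skew_reflection_dual eta w nu) x.
Proof. by rewrite dotDr dotZr dotDl dotZl mulrC. Qed.

(** Let a chord parallel to [w] move with ends [p1 + s *: x + T1 *: w] and [p2 + s *: x + T2 *: w].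
    The relation between the normals gives [T1 + T2] the constant derivative [dot eta x] in [s]. If
    [p1 + x] is on the level set then [T1] vanishes at [s = 1], so [T2] equals [dot eta x] there,
    which is the claim. *)
Lemma transport f p1 p2 eta w (N1 N2 : set V) :
    C1_submersion_near f p1 -> C1_submersion_near f p2 -> f p1 = f p2 ->
    nbhs p1 N1 -> nbhs p2 N2 -> (exists l, p2 - p1 = l *: w) ->
    dot eta w = -2 -> dot (dmx f p1) w != 0 -> dot (dmx f p2) w != 0 ->
    (forall q1 q2, N1 q1 -> N2 q2 -> f q1 = f p1 -> f q2 = f p2 ->
       (exists l, q2 - q1 = l *: w) -> 
       exists2 c, c != 0 & dmx f q2 = c *: skew_reflection_dual eta w (dmx f q1)) ->
  \forall x \near (0 : V), f (p1 + x) = f p1 -> f (p2 + skew_reflection eta w x) = f p2.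
Proof.
move=> C1 C2 fp NN1 NN2 [l pl] ew w1 w2 H.
pose N1' q := N1 q /\ dot (dmx f q) w != 0.
have NN1' : nbhs p1 N1'.
  apply: filterI => //; have [_ c1 _] := nbhs_singleton C1.
  exact: (cvgr_neq0 _ (cvg_dot c1 (@cst_continuous _ _ w p1)) w1).
have [r1 [d1 [T1 [[r10 d10] T1P T1u T1d]]]] := implicit_graph C1 NN1' w1.
have [r2 [d2 [T2 [[r20 d20] T2P T2u T2d]]]] := implicit_graph C2 NN2 w2.
apply/nbhs_addP; exists (Num.min r1 r2) => [|x]; first by rewrite lt_min r10.
rewrite add0r => xr fx.
have xs s : `|s| <= 1 -> `|0 + s *: x| < r1 /\ `|0 + s *: x| < r2.
  move=> s1; apply/andP; rewrite -lt_min add0r normrZ.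
  by apply: le_lt_trans xr; rewrite ler_piMl.
(* Twice the deviation, along [w], of the midpoint of the chord from uniform motion. *)
pose g (s : R) := T1 (0 + s *: x) + T2 (0 + s *: x) - dot eta x * s.
have dg (s : R) : `|s| <= 1 -> is_derive s 1 g 0.
  move=> /xs[s1 s2].
  have [_ [N1s n0] f1] := T1P _ s1; have [_ N2s f2] := T2P _ s2.
  have d1s := T1d _ _ _ s1; have d2s := T2d _ _ _ s2.
  move: d1s d2s => /=.
  move: N1s n0 f1 N2s f2 (H _ _ N1s N2s f1 f2).
  have : exists l, p2 + (0 + s *: x) + T2 (0 + s *: x) *: w -
      (p1 + (0 + s *: x) + T1 (0 + s *: x) *: w) = l *: w.
    exists (l + T2 (0 + s *: x) - T1 (0 + s *: x)).
    by rewrite opprD addrACA (addrC p1) addrKA pl !scalerDl scaleNr addrA.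
  move: (p1 + _ + _) (p2 + _ + _) => q1 q2 ql N1s n0 f1 N2s f2 /(_ ql)[c c0 cE] d1s d2s.
  have d3s := is_deriveZ (dot eta x) (@is_derive_id _ R s 1).
  apply: (is_derive_eq (is_deriveB (is_deriveD d1s d2s) d3s)).
  rewrite cE /skew_reflection_dual !dotZl !dotDl !dotZl ew.
  move: (dot (dmx f q1) w) n0 => a a0.
  rewrite [dot eta x *: _]mulr1.
  have a2 : a + a * -2 != 0 by rewrite (_ : _ + _ = - a) ?oppr_eq0//; ring.
  by field; rewrite a0 c0 a2.
have g0 : g 0 = 0.
  rewrite /g mulr0 subr0 scale0r addr0.
  by rewrite -(T1u 0 0) -?(T2u 0 0) ?normr0 ?scale0r ?addr0.
have [t _ gE] : exists2 t : R, t \in `]0, 1[ & g 1 - g 0 = 0 * (1 - 0).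
  apply: (@MVT R g (fun=> 0)) => //.
    move=> t /[!in_itv]/= /andP[t0 t1]; apply: dg.
    by rewrite gtr0_norm// ltW.
  apply: derivable_within_continuous => t /[!in_itv]/= /andP[t0 t1].
  by have [] : is_derive t 1 g 0 by apply: dg; rewrite ger0_norm.
move: gE; rewrite g0 mul0r subr0 /g add0r scale1r mulr1.
have [x1 x2] : `|x| < r1 /\ `|x| < r2 by apply/andP; rewrite -lt_min.
rewrite -(T1u x 0) ?normr0 ?scale0r ?addr0// add0r => /eqP; rewrite subr_eq0 => /eqP.
by rewrite /skew_reflection => <-; have [_ _] := T2P _ x2; rewrite addrA.
Qed.

End Transport.

(** * Inscribed triangles *)

Section SkewReflection.
Variables (R : realType) (m k : nat).
Local Notation V := 'M[R]_(m, k).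
Local Notation W := 'M[R]_(k, m).
Implicit Types (x a b w : V) (eta nu : W).

Lemma skew_reflectionD eta w x y :
  skew_reflection eta w (x + y) = skew_reflection eta w x + skew_reflection eta w y.
Proof. by rewrite /skew_reflection dotDr scalerDl addrACA. Qed.

Lemma skew_reflectionZ eta w c x :
  skew_reflection eta w (c *: x) = c *: skew_reflection eta w x.
Proof. by rewrite /skew_reflection dotZr scalerDr scalerA. Qed.

Lemma skew_reflection_dualZ eta w c nu :
  skew_reflection_dual eta w (c *: nu) = c *: skew_reflection_dual eta w nu.
Proof. by rewrite /skew_reflection_dual dotZl scalerDr scalerA. Qed.

Lemma skew_reflection_dualK eta w : dot eta w = -2 ->
  involutive (skew_reflection_dual eta w).
Proof.
move=> ew nu; rewrite /skew_reflection_dual dotDl dotZl ew -addrA -scalerDl.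
have -> : dot nu w + (dot nu w + dot nu w * -2) = 0 by ring.
by rewrite scale0r addr0.
Qed.

Lemma skew_reflection_dual_dir eta w nu : dot eta w = -2 ->
  dot (skew_reflection_dual eta w nu) w = - dot nu w.
Proof. by move=> ew; rewrite dotDl dotZl ew; ring. Qed.

(* Up to scaling, the vector of the plane spanned by [a] and [b] that is killed
   by [nu]. *)
Definition plane_kernel a b nu : V := dot nu b *: a - dot nu a *: b.

Lemma plane_kernelZ a b c nu : plane_kernel a b (c *: nu) = c *: plane_kernel a b nu.
Proof. by rewrite /plane_kernel !dotZl scalerBr !scalerA. Qed.

Lemma dot_plane_kernel a b nu : dot nu (plane_kernel a b nu) = 0.
Proof. by rewrite dotBr !dotZr mulrC subrr. Qed.

(* A skew reflection preserving the plane has determinant -1 on it. *)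
Lemma skew_reflection_plane_kernel a b s t eta nu : dot eta (s *: a + t *: b) = -2 ->
  skew_reflection eta (s *: a + t *: b) (plane_kernel a b nu) =
  - plane_kernel a b (skew_reflection_dual eta (s *: a + t *: b) nu).
Proof.
set w := _ + _ => ew; have ew' : s * dot eta a + t * dot eta b = -2 by rewrite -ew dotDr !dotZr.
rewrite /skew_reflection /plane_kernel !dotDl !dotZl !dotBr !dotZr.
have -> : dot nu w = s * dot nu a + t * dot nu b by rewrite dotDr !dotZr.
rewrite /w; apply/matrixP => i j; rewrite !mxE.
set ea := dot eta a in ew' *; set eb := dot eta b in ew' *.
set na := dot nu a; set nb := dot nu b.
apply/eqP; rewrite -subr_eq0; apply/eqP.
transitivity ((s * ea + t * eb + 2) * (nb * a i j - na * b i j)); first by ring.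
by rewrite ew' addNr mul0r.
Qed.

Lemma skew_reflection_plane_kernelZ a b s t w eta nu nu' c :
    w = s *: a + t *: b -> dot eta w = -2 ->
    skew_reflection_dual eta w nu = c *: nu' ->
  skew_reflection eta w (plane_kernel a b nu) = - c *: plane_kernel a b nu'.
Proof.
move=> -> ew E; rewrite skew_reflection_plane_kernel ?ew// E.
by rewrite plane_kernelZ scaleNr.
Qed.

Lemma near0_skew_reflection eta w (P : set V) : (\forall x \near (0 : V), P x) ->
  \forall x \near (0 : V), P (skew_reflection eta w x).
Proof.
move=> /nbhs_addP[r r0 Pr]; pose K := 1 + (k * m)%:R * `|eta| * `|w|.
have K0 : 0 < K by rewrite ltr_pwDl// !mulr_ge0.
apply/nbhs_addP; exists (r / K) => [|x]; first by rewrite divr_gt0.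
rewrite ltr_pdivlMr// add0r => xr; rewrite -[skew_reflection _ _ _]add0r; apply: Pr.
apply: le_lt_trans xr; rewrite (le_trans (ler_normD _ _))// /K mulrDr mulr1 lerD2l.
rewrite normrZ (le_trans (ler_wpM2r _ (dot_le _ _)))//.
by rewrite le_eqVlt; apply/orP; left; apply/eqP; ring.
Qed.

End SkewReflection.

(** * The Ceva-type identity for inscribed triangles *)

Section Ceva.
Variables (R : realType) (m k : nat).
Local Notation V := 'M[R]_(m, k).
(** [Sg] is an open piece of the level [c0] of [f], and [dir] is the set of admissible chord
    directions. *)
Variables (f : V -> R) (c0 eps : R) (Sg dir : set V).
Implicit Types (p q x w : V).

Variable nu : V -> 'M[R]_(k, m).
Hypothesis nuE : forall p, nu p = eps *: dmx f p.

Hypothesis Sg_C1 : forall p, Sg p -> C1_submersion_near f p.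
Hypothesis Sg_level : forall p, Sg p -> f p = c0.
Hypothesis Sg_near : forall p, Sg p -> \forall q \near p, f q = c0 -> Sg q.
Hypothesis Sg_support : forall p q, Sg p -> Sg q -> q != p -> 0 < dot (nu p) (q - p).
Hypothesis dirN : forall w, dir w -> dir (- w).
(** One [eta] serves all chords parallel to [q - p]: in the billiard they are governed by the
    involution at a single point of [U]. *)
Hypothesis Sg_chord : forall p q, Sg p -> Sg q -> dir (q - p) ->
  exists2 eta, dot eta (q - p) = -2 & forall q1 q2, Sg q1 -> Sg q2 -> q2 != q1 ->
    (exists l, q2 - q1 = l *: (q - p)) ->
    exists2 c, 0 < c & nu q2 = c *: skew_reflection_dual eta (q - p) (nu q1).

Lemma skew_reflection_level p q : Sg p -> Sg q -> q != p -> dir (q - p) ->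
  exists2 eta, dot eta (q - p) = -2 &
    (exists2 c, 0 < c & skew_reflection_dual eta (q - p) (nu p) = c *: nu q) /\
    \forall x \near (0 : V), f (p + x) = c0 ->
      f (q + skew_reflection eta (q - p) x) = c0.
Proof.
move=> Sp Sq qp dqp; have [eta ew H] := Sg_chord Sp Sq dqp; exists eta => //.
have l1 : exists l, q - p = l *: (q - p) by exists 1; rewrite scale1r.
have pw := Sg_support Sp Sq qp.
have qw : 0 < dot (nu q) (p - q) by apply: Sg_support => //; rewrite eq_sym.
split.
  have [c cpos ->] := H p q Sp Sq qp l1.
  by exists c^-1; rewrite ?invr_gt0// scalerA mulVf ?scale1r// gt_eqF.
have eps0 : eps != 0.
  by apply: contraTneq pw => eps0; rewrite nuE eps0 scale0r dot0l ltxx.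
(* With this radius the neighbourhoods of [p] and [q] are disjoint, so chords between them are not
   degenerate. *)
pose d := `|q - p| / 2; have d0 : 0 < d by rewrite divr_gt0// normr_gt0 subr_eq0.
pose N r y := (f y = c0 -> Sg y) /\ `|y - r| < d.
have NN r : Sg r -> nbhs r (N r).
  move=> Sr; apply: filterI; first exact: Sg_near.
  by apply/nbhs_addP; exists d => // x; rewrite addrC addKr.
have fpq : f p = f q by rewrite !Sg_level.
have := @transport _ _ _ f p q eta (q - p) (N p) (N q) (Sg_C1 Sp) (Sg_C1 Sq) fpq
  (NN _ Sp) (NN _ Sq) l1 ew.
rewrite (Sg_level Sp) (Sg_level Sq); apply.
- by move: pw; rewrite nuE dotZl; apply: contraTneq => ->; rewrite mulr0 ltxx.
- move: qw; rewrite nuE -opprB dotNr dotZl; apply: contraTneq => ->.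
  by rewrite mulr0 oppr0 ltxx.
move=> q1 q2 [S1 d1] [S2 d2] f1 f2 lq.
have q21 : q2 != q1.
  apply: contraTneq d1 => q12; rewrite -leNgt; rewrite q12 in d2.
  have : `|q - p| <= `|q1 - q| + `|q1 - p|.
    by rewrite -(normrN (q1 - q)) opprB (le_trans _ (ler_normD _ _))// subrKA.
  rewrite /d in d2 *; lra.
have [c cpos] := H _ _ (S1 f1) (S2 f2) q21 lq.
rewrite !nuE skew_reflection_dualZ scalerA mulrC -scalerA => /(scalerI eps0) ->.
by exists c => //; rewrite gt_eqF.
Qed.

(** The height of [q] above the tangent hyperplane at [p]. *)
Let A p q := dot (nu p) (q - p).

(** For [w] an inward normal at [y], the points [0] and [x], hence also [K *: x], lie strictly on
    the inner side of [y]; yet [y] is reached from [K *: x] by moving further inwards along [e]. *)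
Let support_combination (w : 'M[R]_(k, m)) e x y (K t : R) :
    0 < K < 1 -> 0 < t -> y = K *: x + t *: e -> 0 < dot w e ->
  0 < dot w (- y) -> ~ 0 < dot w (x - y).
Proof.
move=> /andP[K0 K1] t0 ->; rewrite dotNr dotBr dotDr !dotZr.
move: (dot w e) (dot w x) => u v u0 h1 h2.
have := mulr_gt0 K0 h2; have := mulr_gt0 t0 u0.
have : 0 < (1 - K) * - (K * v + t * u) by rewrite mulr_gt0// subr_gt0.
lra.
Qed.

(** The inequality means [ka < 1]. The square [L] of the composed reflections preserves the level
    set near [p1]; in the plane of the triangle it contracts the tangent by [ka ^+ 2] and stretches
    heights by the inverse. It thus sends a point [p1 + x] of the section to the inner side of the
    chord from [p1] to [p1 + x], against [support_combination]. *)
Let ceva_not_lt p1 p2 p3 : Sg p1 -> Sg p2 -> Sg p3 ->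
    p2 != p1 -> p3 != p2 -> p1 != p3 ->
    dir (p2 - p1) -> dir (p3 - p2) -> dir (p1 - p3) ->
  ~ A p1 p2 * A p2 p3 * A p3 p1 < A p2 p1 * A p3 p2 * A p1 p3.
Proof.
move=> S1 S2 S3 n12 n23 n31 d12 d23 d31 AA.
have [eta12 e12 [[c12 c12p D12] T12]] := skew_reflection_level S1 S2 n12 d12.
have [eta23 e23 [[c23 c23p D23] T23]] := skew_reflection_level S2 S3 n23 d23.
have [eta31 e31 [[c31 c31p D31] T31]] := skew_reflection_level S3 S1 n31 d31.
have Apos p q : Sg p -> Sg q -> q != p -> 0 < A p q by move=> *; exact: Sg_support.
have cA p q eta c : dot eta (q - p) = -2 ->
    skew_reflection_dual eta (q - p) (nu p) = c *: nu q -> A p q = c * A q p.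
  move=> e /(congr1 (fun mu : 'M[R]_(k, m) => dot mu (q - p))).
  rewrite skew_reflection_dual_dir// dotZl => /eqP.
  by rewrite eqr_oppLR -mulrN -dotNr opprB => /eqP.
have A12 := cA _ _ _ _ e12 D12; have A23 := cA _ _ _ _ e23 D23.
have A31 := cA _ _ _ _ e31 D31.
have A21p : 0 < A p2 p1 by apply: Apos => //; rewrite eq_sym.
have A32p : 0 < A p3 p2 by apply: Apos => //; rewrite eq_sym.
have A13p : 0 < A p1 p3 by apply: Apos => //; rewrite eq_sym.
have A12p : 0 < A p1 p2 by apply: Apos.
(* The quotient of the two products being compared. *)
pose ka := c12 * c23 * c31.
have ka0 : 0 < ka by rewrite !mulr_gt0.
have ka1 : ka < 1.
  move: AA; rewrite A12 A23 A31.
  rewrite (_ : _ * _ * _ = ka * (A p2 p1 * A p3 p2 * A p1 p3)); last by rewrite /ka; ring.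
  by rewrite gtr_pMl// !mulr_gt0.
pose a := p2 - p1; pose b := p3 - p1.
pose H12 := skew_reflection eta12 (p2 - p1).
pose H23 := skew_reflection eta23 (p3 - p2).
pose H31 := skew_reflection eta31 (p1 - p3).
pose M x := H31 (H23 (H12 x)); pose L x := M (M x).
have w12 : p2 - p1 = 1 *: a + 0 *: b by rewrite scale1r scale0r addr0.
have w23 : p3 - p2 = (-1) *: a + 1 *: b.
  by rewrite scaleN1r scale1r /a /b opprB [RHS]addrC subrKA.
have w31 : p1 - p3 = 0 *: a + (-1) *: b by rewrite scale0r add0r scaleN1r opprB.
have LZ c x : L (c *: x) = c *: L x.
  by rewrite /L /M /H12 /H23 /H31 !skew_reflectionZ.
have LD x y : L (x + y) = L x + L y.
  by rewrite /L /M /H12 /H23 /H31 !skew_reflectionD.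
(* Spans the tangent at [p1] to the section by the plane of the triangle. Each reflection carries
   such a kernel vector to the next one with a minus sign, whence the factor [- ka]. *)
pose d := plane_kernel a b (nu p1).
have Md : M d = (- ka) *: d.
  have h12 : H12 d = (- c12) *: plane_kernel a b (nu p2).
    exact: skew_reflection_plane_kernelZ w12 e12 D12.
  have h23 : H23 (plane_kernel a b (nu p2)) = (- c23) *: plane_kernel a b (nu p3).
    exact: skew_reflection_plane_kernelZ w23 e23 D23.
  have h31 : H31 (plane_kernel a b (nu p3)) = (- c31) *: d.
    exact: skew_reflection_plane_kernelZ w31 e31 D31.
  rewrite /M h12 /H23 skew_reflectionZ -/H23 h23 /H31 !skew_reflectionZ -/H31 h31.
  by rewrite !scalerA; congr (_ *: _); rewrite /ka; ring.
have Ld : L d = ka ^+ 2 *: d.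
  rewrite /L Md /M /H12 /H23 /H31 !skew_reflectionZ -/H12 -/H23 -/H31.
  by rewrite -[H31 _]/(M d) Md scalerA mulrNN.
(* The reflections are moved across the pairing from the last to the first; since each transpose is
   an involution, the coefficients appear inverted. *)
have nuM x : dot (nu p1) (M x) = ka^-1 * dot (nu p1) x.
  have D31' : skew_reflection_dual eta31 (p1 - p3) (nu p1) = c31^-1 *: nu p3.
    apply: (scalerI (lt0r_neq0 c31p)); rewrite -skew_reflection_dualZ -D31.
    by rewrite skew_reflection_dualK// scalerA mulfV ?scale1r// gt_eqF.
  have D23' : skew_reflection_dual eta23 (p3 - p2) (nu p3) = c23^-1 *: nu p2.
    apply: (scalerI (lt0r_neq0 c23p)); rewrite -skew_reflection_dualZ -D23.
    by rewrite skew_reflection_dualK// scalerA mulfV ?scale1r// gt_eqF.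
  have D12' : skew_reflection_dual eta12 (p2 - p1) (nu p2) = c12^-1 *: nu p1.
    apply: (scalerI (lt0r_neq0 c12p)); rewrite -skew_reflection_dualZ -D12.
    by rewrite skew_reflection_dualK// scalerA mulfV ?scale1r// gt_eqF.
  rewrite /M /H31 skew_reflection_adj D31' dotZl /H23 skew_reflection_adj D23' dotZl.
  rewrite /H12 skew_reflection_adj D12' dotZl !mulrA /ka !invfM.
  by congr (_ * _); rewrite mulrC (mulrC c31^-1) mulrA.
have nuL x : dot (nu p1) (L x) = ka ^- 2 * dot (nu p1) x.
  by rewrite /L !nuM mulrA -invfM.
have TM : \forall x \near (0 : V), f (p1 + x) = c0 -> f (p1 + M x) = c0.
  have T23' := near0_skew_reflection eta12 (p2 - p1) T23.
  have T31' := near0_skew_reflection eta12 (p2 - p1)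
    (near0_skew_reflection eta23 (p3 - p2) T31).
  near=> x => fx; have fx1 : f (p2 + H12 x) = c0 by move: fx; near: x.
  have fx2 : f (p3 + H23 (H12 x)) = c0 by move: fx1; near: x.
  by move: fx2; near: x.
have nearM P : (\forall x \near (0 : V), P x) -> \forall x \near (0 : V), P (M x).
  move=> H; exact: (near0_skew_reflection _ _ (near0_skew_reflection _ _
    (near0_skew_reflection eta31 (p1 - p3) H))).
have TL : \forall x \near (0 : V), f (p1 + x) = c0 -> f (p1 + L x) = c0.
  have TM' := nearM _ TM.
  near=> x => fx; have fx1 : f (p1 + M x) = c0 by move: fx; near: x.
  by move: fx1; near: x.
have ap : 0 < dot (nu p1) a by [].
have bp : 0 < dot (nu p1) b by apply: Sg_support => //; rewrite eq_sym.
(* Otherwise the three points are aligned: support at [p3] puts [p2] between the other two, where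
   support at [p2] fails. *)
have d0 : d != 0.
  apply/negP => /eqP; rewrite /d /plane_kernel => /eqP; rewrite subr_eq0 => /eqP dab.
  pose l := dot (nu p1) b / dot (nu p1) a.
  have l0 : 0 < l by rewrite divr_gt0.
  have bE : b = l *: a.
    apply: (scalerI (lt0r_neq0 ap)); rewrite -dab scalerA mulrC divfK//.
    by rewrite gt_eqF.
  have p32 : p3 - p2 = (l - 1) *: a.
    have -> : p3 - p2 = b - a by rewrite /a /b opprB subrKA.
    by rewrite {1}bE scalerBl scale1r.
  have h1 := Sg_support S3 S1 n31.
  have h2 : 0 < dot (nu p3) (p2 - p3) by apply: Sg_support => //; rewrite eq_sym.
  have h3 := Sg_support S2 S3 n23.
  have h4 : 0 < dot (nu p2) (p1 - p2) by apply: Sg_support => //; rewrite eq_sym.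
  move: h1 h2 h3 h4; rewrite -(opprB p3) -/b bE -(opprB p3 p2) -(opprB p2 p1) p32 -/a.
  rewrite !dotNr !dotZr !oppr_gt0.
  rewrite pmulr_rlt0// => h1; rewrite nmulr_llt0// => h2 + h4.
  by rewrite pmulr_rgt0// ltNge ltW.
(* On the plane, [L] is the homothety of ratio [ka ^+ 2] plus a multiple of [e], because it acts on
   [d] as that homothety; and [e] points inwards at [p1]. *)
pose e := L a - ka ^+ 2 *: a.
have e0 : 0 < dot (nu p1) e.
  rewrite dotBr nuL dotZr -mulrBl mulr_gt0// subr_gt0.
  rewrite (@lt_trans _ _ 1)//; first by rewrite exprn_ilt1// ltW.
  by rewrite invf_gt1 ?exprn_gt0// exprn_ilt1// ltW.
have nuc : \forall x \near (0 : V), 0 < dot (nu (p1 + x)) e.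
  have [_ c1 _] := nbhs_singleton (Sg_C1 S1).
  have e1 : 0 < dot (dmx f p1) (eps *: e) by move: e0; rewrite nuE dotZl dotZr.
  have := near0_add (near_dot_gt c1 (@cst_continuous _ _ (eps *: e) p1) e1).
  by apply: filterS => x; rewrite nuE dotZl dotZr.
have SL : \forall x \near (0 : V), f (p1 + x) = c0 -> Sg (p1 + x).
  exact: (near0_add (P := fun q => f q = c0 -> Sg q)) (Sg_near S1).
have nearL P : (\forall x \near (0 : V), P x) -> \forall x \near (0 : V), P (L x).
  by move=> /nearM/nearM.
have [r r0 good] : exists2 r, 0 < r & forall x, `|x| < r -> f (p1 + x) = c0 ->
    [/\ Sg (p1 + x), Sg (p1 + L x) & 0 < dot (nu (p1 + L x)) e].
  have SL' := nearL _ SL; have nuc' := nearL _ nuc.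
  suff /nbhs_addP[r r0 H] : \forall x \near (0 : V), f (p1 + x) = c0 ->
      [/\ Sg (p1 + x), Sg (p1 + L x) & 0 < dot (nu (p1 + L x)) e].
    by exists r => // x; rewrite -{2 3 4 5}[x]add0r; exact: H.
  near=> x => fx; split; first by move: fx; near: x.
    have fLx : f (p1 + L x) = c0 by move: fx; near: x.
    by move: fLx; near: x.
  by near: x.
(* The factor [eps] makes the transversal pair positively with the differential itself; the point
   found by [tangent_point] stays in the plane of the triangle. *)
have ape : 0 < dot (dmx f p1) (eps *: a) by move: ap; rewrite nuE dotZl dotZr.
have dk : dot (dmx f p1) d = 0.
  have /eqP := dot_plane_kernel a b (nu p1).
  rewrite {1}nuE dotZl mulf_eq0 => /orP[/eqP eps0|/eqP//].
  by move: ap; rewrite nuE eps0 scale0r dot0l ltxx.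
have df1 : \forall q \near p1, differentiable f q by apply: filterS (Sg_C1 S1) => q [].
have tp := tangent_point df1 dk ape ltr01.
have D0 : 0 < `|d| + `|eps *: a| by rewrite ltr_pwDl// normr_gt0.
near (0 : R)^'+ => s.
have s0 : 0 < s by near: s; exact: nbhs_right_gt.
have sD : s * (`|d| + `|eps *: a|) < r.
  by rewrite -ltr_pdivlMr//; near: s; apply: nbhs_right_lt; rewrite divr_gt0.
have [tau tau1 fx] : exists2 tau, `|tau| <= 1 & f (p1 + s *: (d + tau *: (eps *: a))) = f p1.
  by near: s.
set x := s *: _ in fx.
have xr : `|x| < r.
  rewrite (le_lt_trans _ sD)// normrZ gtr0_norm// ler_pM2l// (le_trans (ler_normD _ _))//.
  by rewrite lerD2l normrZ ler_piMl.
have {}fx : f (p1 + x) = c0 by rewrite fx Sg_level.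
have [Sx SLx Le] := good _ xr fx.
have nux : dot (nu p1) x = s * (tau * (eps * dot (nu p1) a)).
  by rewrite dotZr dotDr dot_plane_kernel add0r !dotZr.
have eps0 : eps != 0.
  by apply: contraTneq ap => eps0; rewrite nuE eps0 scale0r dot0l ltxx.
have x0 : x != 0.
  apply/eqP => x0; move: nux; rewrite x0 dot0r => /esym/eqP.
  rewrite !mulf_eq0 (gt_eqF s0) (gt_eqF ap) (negbTE eps0) !orbF/= => /eqP tau0.
  move/eqP: x0; rewrite /x tau0 scale0r addr0 scaler_eq0 (gt_eqF s0)/=.
  by apply/negP.
have px y : p1 + y - p1 = y by rewrite addrC addKr.
have nu1x : 0 < dot (nu p1) x.
  rewrite -(px x); apply: Sg_support => //.
  by rewrite -subr_eq0 px.
have st : 0 < s * (tau * eps) by move: nu1x; rewrite nux !mulrA pmulr_lgt0.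
have ka2 : 0 < ka ^+ 2 < 1 by rewrite exprn_gt0// exprn_ilt1// ltW.
have [ka20 ka21] := andP ka2.
have kai : 1 < ka ^- 2 by rewrite invf_gt1.
have Lx0 : L x != 0.
  apply/eqP => E; have /esym/eqP := nuL x; rewrite E dot0r mulf_eq0 (gt_eqF nu1x) orbF.
  by rewrite gt_eqF// (lt_trans _ kai).
have Lxx : L x != x.
  apply/eqP => E; have /esym/eqP := nuL x; rewrite E -subr_eq0 -{2}[dot _ x]mul1r -mulrBl.
  by rewrite gt_eqF// mulr_gt0// subr_gt0.
have LxE : L x = ka ^+ 2 *: x + (s * (tau * eps)) *: e.
  rewrite /x LZ LD LZ LZ Ld /e; move: (L a) => La.
  by apply/matrixP => i j; rewrite !mxE; ring.
have h1 : 0 < dot (nu (p1 + L x)) (p1 - (p1 + L x)).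
  by apply: Sg_support => //; rewrite eq_sym -subr_eq0 px.
have h2 : 0 < dot (nu (p1 + L x)) (p1 + x - (p1 + L x)).
  apply: Sg_support => //; rewrite (inj_eq (addrI p1)) eq_sym //.
move: h1 h2; rewrite opprD addNKr addrACA subrr add0r => h1 h2.
exact: (@support_combination (nu (p1 + L x)) e x (L x) _ _ ka2 st LxE Le h1 h2).
Unshelve. all: by end_near. Qed.

(** Reversing the orientation of the triangle exchanges the two products, so [ceva_not_lt] excludes
    both strict inequalities. *)
Lemma ceva p1 p2 p3 : Sg p1 -> Sg p2 -> Sg p3 ->
    p2 != p1 -> p3 != p2 -> p1 != p3 ->
    dir (p2 - p1) -> dir (p3 - p2) -> dir (p1 - p3) ->
  dot (nu p1) (p2 - p1) * dot (nu p2) (p3 - p2) * dot (nu p3) (p1 - p3) =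
  dot (nu p2) (p1 - p2) * dot (nu p3) (p2 - p3) * dot (nu p1) (p3 - p1).
Proof.
move=> S1 S2 S3 n12 n23 n31 d12 d23 d31; rewrite -!/(A _ _).
apply/eqP; rewrite eq_le !leNgt; apply/andP; split; apply/negP.
  move=> H; apply: (@ceva_not_lt p1 p3 p2) => //; rewrite 1?eq_sym//.
  - by rewrite -opprB; exact: dirN.
  - by rewrite -opprB; exact: dirN.
  - by rewrite -opprB; exact: dirN.
  rewrite (_ : A p1 p3 * _ * _ = A p2 p1 * A p3 p2 * A p1 p3); last by ring.
  by rewrite (_ : A p3 p1 * _ * _ = A p1 p2 * A p2 p3 * A p3 p1)//; ring.
exact: ceva_not_lt.
Qed.

(* By [ceva] the normals can be rescaled so that [dot (N p + N q) (p - q) = 0]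
   for all chords; the equation follows by pairing with the coordinates of [p]. *)
Lemma barycentric_equation (I : finType) (a0 : V) (a : I -> V) (beta : I -> R) p :
    Sg a0 -> Sg p -> (forall i, Sg (a i)) -> p != a0 ->
    (forall i, a i != a0) -> (forall i, a i != p) ->
    dir (p - a0) -> (forall i, dir (a i - p)) -> (forall i, dir (a0 - a i)) ->
    p - a0 = \sum_i beta i *: (a i - a0) ->
  2 * dot (nu a0) (p - a0) + \sum_i beta i *
    dot ((dot (nu a0) (a i - a0) / dot (nu (a i)) (a0 - a i)) *: nu (a i) - nu a0) (p - a0) = 0.
Proof.
move=> S0 Sp Sa p0 ai0 aip dp dap d0a pE.
(* Scaled so that [Np + nu a0] vanishes on [p - a0], and likewise [N i + nu a0] on [a i - a0]. *)
pose Np := (A a0 p / A p a0) *: nu p.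
pose N i := (A a0 (a i) / A (a i) a0) *: nu (a i).
have Ap0 : A p a0 != 0 by rewrite gt_eqF// Sg_support// eq_sym.
have Npx : dot Np (p - a0) = - dot (nu a0) (p - a0).
  by rewrite dotZl -(opprB a0) (dotNr (nu p)) mulrN divfK// -dotNr opprB -dotNr opprB.
have Ai0 i : A (a i) a0 != 0 by rewrite gt_eqF// Sg_support// eq_sym.
have Nib i : dot (N i) (a i - a0) = - dot (nu a0) (a i - a0).
  by rewrite dotZl -(opprB a0) (dotNr (nu (a i))) mulrN divfK// -dotNr opprB -dotNr opprB.
have Nip i : dot (N i) (p - a i) = dot Np (a i - p).
  (* Once the normals are matched on two sides of the triangle, [ceva] matches them on the third. *)
  have := @ceva a0 p (a i) S0 Sp (Sa i) p0 (aip i).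
  rewrite eq_sym => /(_ (ai0 i) dp (dap i) (d0a i)).
  rewrite !dotZl -!/(A _ _) => E.
  have := Ai0 i; move: (A a0 (a i)) (A (a i) a0) (A (a i) p) (A a0 p) (A p a0) (A p (a i)) E Ap0.
  move=> u v w x y z E y0 v0.
  have -> : u / v * w = y * w * u / (v * y) by field; rewrite v0 y0.
  by rewrite -E; field; rewrite v0 y0.
have key i : dot (N i) (p - a0) = dot Np (a i - a0) - dot (nu a0) (a i - a0)
   + dot (nu a0) (p - a0).
  have h1 : p - a0 = (p - a i) + (a i - a0) by rewrite subrKA.
  have h2 : a i - p = (a i - a0) - (p - a0) by rewrite opprB subrKA.
  by rewrite [in LHS]h1 (dotDr (N i)) Nib Nip h2 (dotBr Np) Npx; ring.
(* The weights [beta i] turn [a i - a0] into [p - a0], on which [Np] takes the value of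
   [- nu a0]. *)
transitivity (2 * dot (nu a0) (p - a0) + \sum_i (dot (Np - nu a0) (beta i *: (a i - a0)))).
  congr (_ + _); apply: eq_bigr => i _.
  by rewrite dotBl -/(N i) key dotZr dotBl; ring.
by rewrite -dot_sumr -pE dotBl Npx; ring.
Qed.

End Ceva.

(** * Quadrics *)

Section Quadric.
Variables (R : realType) (n : nat).
Local Notation mp := (mpoly.mpoly n R).
Local Notation size_mp := (@mpoly.mmeasure n R (@mpoly.mdeg n)).

(** Second differences vanish in degree at most one. This serves to bound a degree from below. *)
Lemma meval_affine (P : mp) (v w : 'I_n -> R) : (size_mp P <= 2)%N ->
  mpoly.meval v P + mpoly.meval (fun i => v i + 2 * w i) P =
  2 * mpoly.meval (fun i => v i + w i) P.
Proof.
move=> P2; rewrite !mpoly.mevalE -big_split mulr_sumr /=; apply: eq_big_seq => m mP.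
have md : (mpoly.mdeg m < 2)%N := leq_trans (mpoly.mmeasure_mnm_lt _ mP) P2.
rewrite -!mpoly.mevalX.
case: (mpoly.mdeg m) (mpoly.mdeg_eq0 m) (mpoly.mdeg_eq1 m) md => [|[|//]].
  rewrite eqxx => /esym/eqP -> _ _; rewrite mpoly.mpolyX0 !mpoly.meval1; ring.
rewrite eqxx => _ /esym/existsP[i /eqP ->] _; rewrite !mpoly.mevalXU; ring.
Qed.

Definition affine_mpoly (c : 'rV[R]_n) (d : R) : mp :=
  \sum_j c 0 j *: mpoly.mpolyX R (mpoly.mnm1 j) + mpoly.mpolyC n d.

Lemma msize_affine_mpoly c d : (size_mp (affine_mpoly c d) <= 2)%N.
Proof.
rewrite (leq_trans (mpoly.mmeasureD_le _ _ _))// geq_max; apply/andP; split.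
  rewrite (leq_trans (mpoly.mmeasure_sum _ _ _ _))//; apply/bigmax_leqP => j _.
  by rewrite (leq_trans (mpoly.mmeasureZ_le _ _ _))// mpoly.msizeX mpoly.mdeg1.
by rewrite mpoly.mmeasureC; case: (_ != _).
Qed.

Lemma meval_affine_mpoly c d (p : 'cV[R]_n) :
  mpoly.meval (fun i => p i 0) (affine_mpoly c d) = dot c p + d.
Proof.
rewrite mpoly.mevalD mpoly.mevalC raddf_sum /= dotE big_ord1; congr (_ + _).
by apply: eq_bigr => j _; rewrite mpoly.mevalZ mpoly.mevalXU.
Qed.

(** The hypothesis on [e] keeps the quadratic part from cancelling, so that the degree is exactly
    two. *)
Lemma quadric_form (A B : 'M[R]_n) (c : 'rV[R]_n) (a e : 'cV[R]_n) :
    \sum_i dot (row i A) e * dot (row i B) e != 0 ->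
  quadric [set p : 'cV[R]_n | dot c (p - a) +
    \sum_i dot (row i A) (p - a) * dot (row i B) (p - a) = 0].
Proof.
move=> e0; pose aff (c : 'rV[R]_n) := affine_mpoly c (- dot c a).
pose P := aff c + \sum_i aff (row i A) * aff (row i B).
have PE (p : 'cV[R]_n) : mpoly.meval (fun i => p i 0) P = dot c (p - a) +
    \sum_i dot (row i A) (p - a) * dot (row i B) (p - a).
  rewrite mpoly.mevalD meval_affine_mpoly dotBr raddf_sum/=; congr (_ + _).
  by apply: eq_bigr => i _; rewrite mpoly.mevalM !meval_affine_mpoly !dotBr.
exists P; last by apply/seteqP; split => p /=; rewrite PE.
apply/eqP; rewrite eqn_leq; apply/andP; split.
  rewrite (leq_trans (mpoly.mmeasureD_le _ _ _))// geq_max.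
  rewrite (leq_trans (msize_affine_mpoly _ _))//=.
  rewrite (leq_trans (mpoly.mmeasure_sum _ _ _ _))//; apply/bigmax_leqP => i _.
  have [->|pz] := eqVneq (aff (row i A)) 0; first by rewrite mul0r mpoly.msize0.
  have [->|qz] := eqVneq (aff (row i B)) 0; first by rewrite mulr0 mpoly.msize0.
  rewrite mpoly.msizeM// -subn1 leq_subLR.
  exact: (leq_add (msize_affine_mpoly _ _) (msize_affine_mpoly _ _)).
(* The second difference at [a], [a + e], [a + 2 *: e] is twice the quadratic part at [e]. *)
rewrite ltnNge; apply/negP => /(meval_affine (fun i => a i 0) (fun i => e i 0)).
have -> : (fun i => a i 0 + 2 * e i 0) = (fun i => (a + 2 *: e) i 0).
  by apply/funext => i; rewrite !mxE.
have -> : (fun i => a i 0 + e i 0) = (fun i => (a + e) i 0).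
  by apply/funext => i; rewrite !mxE.
rewrite !PE subrr !(addrC a) !addrK dot0r add0r dotZr.
rewrite big1 ?add0r; last by move=> i _; rewrite !dot0r mulr0.
have -> : \sum_i dot (row i A) (2 *: e) * dot (row i B) (2 *: e) =
    4 * \sum_i dot (row i A) e * dot (row i B) e.
  by rewrite mulr_sumr; apply: eq_bigr => i _; rewrite !dotZr; ring.
move/eqP: e0; set q := \sum_i _; move: (dot c e) => l q0 h; apply: q0; lra.
Qed.

End Quadric.

(** * Chords spanning the space *)

Section Basis.
Variables (R : realType) (n : nat).
Local Notation V := 'cV[R]_n.

(** Greedy choice: fewer than [n] vectors are killed by some nonzero [eta], and any [x] in [X] not
    killed by [eta] is independent of them. *)
Lemma exists_basis (X : set V) :
    (forall eta : 'rV[R]_n, eta != 0 -> exists2 x, X x & dot eta x != 0) ->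
  exists2 b : 'I_n -> V, forall i, X (b i) & \matrix_(i, j) b j i 0 \in unitmx.
Proof.
move=> HX; suff H k : (k <= n)%N -> exists2 b : 'I_k -> V, forall i, X (b i) &
    forall c : 'I_k -> R, \sum_i c i *: b i = 0 -> forall i, c i = 0.
  have [b Xb bfree] := H _ (leqnn n); exists b => //.
  rewrite -unitmx_tr -row_free_unit; apply: inj_row_free => v vb.
  apply/rowP => j; rewrite mxE; apply: (bfree (v 0)).
  apply/matrixP => i l; rewrite ord1; move/rowP/(_ i): vb; rewrite !mxE summxE.
  by apply: etrans; apply: eq_bigr => j' _; rewrite !mxE.
elim: k => [_|k IH kn]; first by exists (fun=> 0) => [[]|c _ []].
have [b Xb bfree] := IH (ltnW kn).
pose B : 'M[R]_(n, k) := \matrix_(i, j) b j i 0.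
have [eta eta0 etaB] : exists2 eta : 'rV[R]_n, eta != 0 & eta *m B = 0.
  have : kermx B != 0.
    rewrite -mxrank_eq0 mxrank_ker subn_eq0 -ltnNge.
    by rewrite (leq_ltn_trans (rank_leq_col _)).
  move=> /rowV0Pn[eta /sub_kermxP eB eta0]; by exists eta.
have etab i : dot eta (b i) = 0.
  move/matrixP: etaB => /(_ 0 i); rewrite !mxE => <-.
  by rewrite dotE big_ord1; apply: eq_bigr => j _; rewrite mxE.
have [x Xx ex] := HX _ eta0.
exists (fun i => oapp b x (unlift ord0 i)) => [i|c].
  by case: unliftP => [j _|_] /=.
rewrite big_ord_recl unlift_none /=.
under eq_bigr => i _ do rewrite liftK /=.
move=> c0; have c00 : c ord0 = 0.
  have /eqP := congr1 (dot eta) c0.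
  rewrite dot0r dotDr dotZr dot_sumr big1 => [|i _]; last by rewrite dotZr etab mulr0.
  by rewrite addr0 mulf_eq0 (negbTE ex) orbF => /eqP.
move: c0; rewrite c00 scale0r add0r => /bfree cl i.
by case: (unliftP ord0 i) => [j ->|->].
Qed.
End Basis.

(** * Cones of chord directions *)

Section Cone.
Variables (R : realType) (m k : nat).
Local Notation V := 'M[R]_(m, k).
Variables (w0 : V) (delta : R).

(** The open cone over the ball of radius [delta] about [w0]. Its stability under sums lets chords
    be concatenated. *)
Definition cone : set V := [set x | exists2 t, 0 < t & `|x - t *: w0| < delta * t].

Lemma coneD x y : cone x -> cone y -> cone (x + y).
Proof.
move=> [s s0 xs] [t t0 yt]; exists (s + t); first exact: addr_gt0.
rewrite scalerDl opprD addrACA mulrDr (le_lt_trans (ler_normD _ _))//.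
exact: ltrD.
Qed.

Lemma coneZ s x : 0 < s -> cone x -> cone (s *: x).
Proof.
move=> s0 [t t0 xt]; exists (s * t); first exact: mulr_gt0.
by rewrite -scalerA -scalerBr normrZ gtr0_norm// mulrCA ltr_pM2l.
Qed.

Lemma cone_near x : cone x -> \forall y \near x, cone y.
Proof.
move=> [t t0 xt]; apply/nbhs_addP; exists (delta * t - `|x - t *: w0|).
  by rewrite subr_gt0.
move=> y; rewrite ltrBrDl => yt; exists t => //; rewrite addrAC.
exact: le_lt_trans (ler_normD _ _) yt.
Qed.

Lemma cone0 : delta <= `|w0| -> ~ cone 0.
Proof.
move=> dw [t t0]; rewrite sub0r normrN normrZ gtr0_norm// mulrC ltr_pM2r//.
by rewrite ltNge dw.
Qed.

Lemma cone_axis : 0 < delta -> cone w0.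
Proof. by move=> d0; exists 1; rewrite ?ltr01// scale1r subrr normr0 mulr1. Qed.

End Cone.

(** * Points of the germ in general position *)

Section Spanning.
Variables (R : realType) (n : nat).
Local Notation V := 'cV[R]_n.

Lemma tangent_germ (f : V -> R) (O u e : V) (Sg C : set V) :
    C1_submersion_near f O -> (\forall q \near O, f q = f O -> Sg q) ->
    dot (dmx f O) u = 0 -> 0 < dot (dmx f O) e -> (\forall y \near u, C y) ->
  exists2 rho0, 0 < rho0 & forall rho, 0 < rho < rho0 -> \forall s \near 0^'+,
    exists tau, [/\ `|tau| <= rho, Sg (O + s *: (u + tau *: e)) & C (u + tau *: e)].
Proof.
move=> C1f nS du de /nbhs_addP[r r0 Cu]; have e1 : 0 < `|e| + 1 by rewrite ltr_wpDl.
exists (r / (`|e| + 1)) => [|rho /andP[rho0]]; first by rewrite divr_gt0.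
rewrite ltr_pdivlMr// => rho1.
have df : \forall q \near O, differentiable f q by apply: filterS C1f => q [].
have tp := tangent_point df du de rho0.
have [d d0 Sd] := (nbhs_addP _ _).1 nS.
have D0 : 0 < `|u| + r by rewrite ltr_wpDl.
near=> s.
have s0 : 0 < s by near: s; exact: nbhs_right_gt.
have sD : s * (`|u| + r) < d.
  by rewrite -ltr_pdivlMr//; near: s; apply: nbhs_right_lt; rewrite divr_gt0.
have [tau taur fE] : exists2 tau, `|tau| <= rho & f (O + s *: (u + tau *: e)) = f O.
  by near: s.
have te : `|tau *: e| < r.
  rewrite normrZ (le_lt_trans (ler_wpM2r _ taur))// (le_lt_trans _ rho1)//.
  by rewrite ler_pM2l// lerDl.
exists tau; split=> //; last exact: Cu.
apply: Sd => //; rewrite (le_lt_trans _ sD)// normrZ gtr0_norm// ler_pM2l//.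
by rewrite (le_trans (ler_normD _ _))// lerD2l ltW.
Unshelve. all: by end_near. Qed.

(** Take [a0] behind [O] with respect to [w0] and look for the [a i] ahead of it. If no choice
    spans, some nonzero [eta] kills all [a - a0]; then it kills [O - a0] and the tangent hyperplane
    at [O], so it is normal at [O], and strict support at [O] is contradicted by [a0]. *)
Lemma spanning_chords (f : V -> R) (O w0 : V) (Sg : set V) (eps delta : R) :
    C1_submersion_near f O -> (\forall q \near O, f q = f O -> Sg q) ->
    (forall q, Sg q -> q != O -> 0 < dot (eps *: dmx f O) (q - O)) ->
    dot (dmx f O) w0 = 0 -> 0 < delta <= `|w0| ->
  exists a0, exists a : 'I_n -> V, [/\ Sg a0 /\ cone w0 delta (O - a0),
    forall i, Sg (a i) /\ cone w0 delta (a i - O) &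
    \matrix_(i, j) (a j - a0) i 0 \in unitmx].
Proof.
move=> C1f nS sup dw /andP[d0 dw0].
have [_ _ /[dup] n0 /dot_neq0[e e0]] := nbhs_singleton C1f.
have [a0 [Sa0 Ca0]] : exists a0, Sg a0 /\ cone w0 delta (O - a0).
  have dw' : dot (dmx f O) (- w0) = 0 by rewrite dotNr dw oppr0.
  have nC : \forall y \near - w0, cone w0 delta (- y).
    have /nbhs_addP[r r0 Cr] := cone_near (cone_axis w0 d0).
    apply/nbhs_addP; exists r => // x xr; rewrite opprD opprK.
    by apply: Cr; rewrite normrN.
  have [rho0 rp H] := tangent_germ C1f nS dw' e0 nC.
  near (0 : R)^'+ => s.
  have s0 : 0 < s by near: s; exact: nbhs_right_gt.
  have [tau [_ Sa Ca]] : exists tau, [/\ `|tau| <= rho0 / 2,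
     Sg (O + s *: (- w0 + tau *: e)) & cone w0 delta (- (- w0 + tau *: e))].
    near: s; apply: H; rewrite divr_gt0//= ltr_pdivrMr// ltr_pMr// ltr1n//.
  exists (O + s *: (- w0 + tau *: e)); split=> //.
  by rewrite opprD addrA subrr add0r -scalerN; apply: coneZ.
pose X b := exists a, [/\ Sg a, cone w0 delta (a - O) & b = a - a0].
have [|b Xb bu] := @exists_basis _ _ X; last first.
  have /choice[a aP] : forall i, exists a, [/\ Sg a, cone w0 delta (a - O) & b i = a - a0].
    by move=> i; exact: Xb.
  exists a0, a; split=> //; first by move=> i; have [] := aP i.
  rewrite (_ : \matrix_(i, j) _ = \matrix_(i, j) b j i 0)//.
  by apply/matrixP => i j; rewrite !mxE; have [_ _ ->] := aP j; rewrite !mxE.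
move=> eta eta0; apply: contrapT => noX.
have etaX a : Sg a -> cone w0 delta (a - O) -> dot eta (a - a0) = 0.
  move=> Sa Ca; apply/eqP/negPn/negP => ea; apply: noX.
  by exists (a - a0) => //; exists a.
(* Points [a] near [O] almost in direction [u] satisfy [dot eta (a - a0) = 0]. Small [s] gives the
   first equation; then dividing by [s] and taking [rho] small gives the second. *)
have ez u : cone w0 delta u -> dot (dmx f O) u = 0 ->
    dot eta (O - a0) = 0 /\ dot eta u = 0.
  move=> Cu du; have [rho0 rp H] := tangent_germ C1f nS du e0 (cone_near Cu).
  pose B := `|dot eta u| + rho0 * `|dot eta e|.
  have B0 : 0 <= B by rewrite addr_ge0// mulr_ge0// ltW.
  have step rho : 0 < rho < rho0 -> \forall s \near 0^'+, exists2 tau, `|tau| <= rho &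
      dot eta (O - a0) + s * dot eta (u + tau *: e) = 0.
    move=> /H; apply: filter_app; near=> s => -[tau [taur Sa Ca]]; exists tau => //.
    have s0 : 0 < s by near: s; exact: nbhs_right_gt.
    rewrite -dotZr -dotDr addrAC; apply: etaX => //.
    have -> : O + s *: (u + tau *: e) - O = s *: (u + tau *: e) by rewrite addrC addKr.
    exact: coneZ.
  have etaO : dot eta (O - a0) = 0.
    apply/eqP/negPn/negP; rewrite -normr_gt0 => O0.
    near (0 : R)^'+ => s.
    have s0 : 0 < s by near: s; exact: nbhs_right_gt.
    have sB : s * (B + 1) < `|dot eta (O - a0)|.
      rewrite -ltr_pdivlMr ?ltr_wpDl//; near: s; apply: nbhs_right_lt.
      by rewrite divr_gt0// ltr_wpDl.
    have [tau taur /eqP] : exists2 tau, `|tau| <= rho0 / 2 &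
        dot eta (O - a0) + s * dot eta (u + tau *: e) = 0.
      by near: s; apply: step; rewrite divr_gt0//= ltr_pdivrMr// ltr_pMr// ltr1n.
    rewrite addr_eq0 => /eqP OE; move: sB; rewrite OE normrN normrM gtr0_norm//.
    rewrite ltr_pM2l// ltNge => /negP; apply.
    rewrite dotDr dotZr (le_trans (ler_normD _ _))// -addrA lerD2l normrM.
    rewrite ler_wpDr// ler_wpM2r// (le_trans taur)// ler_pdivrMr// ler_pMr// ler1n//.
  split=> //; apply/eqP/negPn/negP; rewrite -normr_gt0 => u0.
  pose rho := Num.min (rho0 / 2) (`|dot eta u| / 2 / (`|dot eta e| + 1)).
  have e1 : 0 < `|dot eta e| + 1 by rewrite ltr_wpDl.
  have rhoP : 0 < rho < rho0.
    rewrite lt_min !divr_gt0//= gt_min; apply/orP; left.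
    by rewrite ltr_pdivrMr// ltr_pMr// ltr1n.
  near (0 : R)^'+ => s.
  have s0 : 0 < s by near: s; exact: nbhs_right_gt.
  have [tau taur /eqP] : exists2 tau, `|tau| <= rho &
      dot eta (O - a0) + s * dot eta (u + tau *: e) = 0 by near: s; exact: step.
  rewrite etaO add0r mulf_eq0 (gt_eqF s0)/= dotDr dotZr addr_eq0 => /eqP uE.
  have : `|tau| * `|dot eta e| <= `|dot eta u| / 2.
    have : `|tau| <= `|dot eta u| / 2 / (`|dot eta e| + 1).
      by rewrite (le_trans taur)// ge_min lexx orbT.
    rewrite ler_pdivlMr// => /(le_trans _); apply.
    by rewrite ler_wpM2l// lerDl.
  rewrite -normrM -(normrN (tau * _)) -uE leNgt => /negP; apply.
  by rewrite ltr_pdivrMr// ltr_pMr// ltr1n.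
have [etaO etaw] := ez _ (cone_axis w0 d0) dw.
(* For tangent [v] and small [t], [w0 + t *: v] is still a tangent vector in the cone. *)
have [v dv|c cE] := @dot_proportional _ _ _ (dmx f O) eta n0.
  pose t := delta / (`|v| + 1); have v1 : 0 < `|v| + 1 by rewrite ltr_wpDl.
  have t0 : 0 < t by rewrite divr_gt0.
  have [||_] := ez (w0 + t *: v).
  - exists 1; rewrite ?ltr01// scale1r mulr1.
    have -> : w0 + t *: v - w0 = t *: v by rewrite addrC addKr.
    rewrite normrZ gtr0_norm//.
    by rewrite /t -mulrA gtr_pMr// mulrC ltr_pdivrMr// mul1r ltrDl.
  - by rewrite dotDr dw dotZr dv mulr0 addr0.
  by rewrite dotDr etaw add0r dotZr => /eqP; rewrite mulf_eq0 (gt_eqF t0)/= => /eqP.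
have a0O : a0 != O.
  apply/eqP => aO; move: Ca0; rewrite aO subrr; exact: cone0.
have := sup _ Sa0 a0O; rewrite dotZl -opprB dotNr.
move/eqP: etaO; rewrite cE dotZl mulf_eq0 => /orP[/eqP c0|/eqP ->].
  by move: eta0; rewrite cE c0 scale0r eqxx.
by rewrite oppr0 mulr0 ltxx.
Unshelve. all: by end_near. Qed.
End Spanning.

(** * The theorem *)

(** Since [H] fixes the kernel of [w], it adds to each vector a multiple of one vector [eta].
    Squaring to the identity forces [dot eta w = -2] unless [eta] is zero, which the eigenvalue -1
    excludes. So [H] is the transpose of a skew reflection of the dual space along [dmx f q]. *)
Lemma involution_fixingP (R : realType) (n : nat) (f : 'rV[R]_n -> R) (q : 'rV[R]_n)
    (H : 'M[R]_n) :
    dmx f q != 0 -> involution_fixing (tangent_hyperplane f q) H ->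
  exists2 eta : 'rV[R]_n, dot eta (dmx f q) = -2 &
    forall nu : 'rV[R]_n, nu *m H = skew_reflection_dual eta (dmx f q) nu.
Proof.
set w := dmx f q => w0 [HH fixH rkH].
have fixP v : dot w v = 0 -> v *m H = v.
  move=> dv; have /fixH/eigenspaceP : tangent_hyperplane f q v.
    by rewrite /tangent_hyperplane /= diff_dot.
  by rewrite scale1r.
have [e e0] := dot_neq0 w0.
pose eta := (dot w e)^-1 *: (e *m H - e).
have sym v : dot w v = dot v w.
  by rewrite !dotE big_ord1 exchange_big big_ord1; apply: eq_bigr => i _; rewrite mulrC.
have HE v : v *m H = skew_reflection_dual eta w v.
  have : dot w (v - (dot w v / dot w e) *: e) = 0.
    by rewrite dotBr dotZr divfK ?subrr// gt_eqF.
  move=> /fixP; rewrite mulmxBl -scalemxAl => /eqP.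
  rewrite subr_eq => /eqP ->; rewrite /skew_reflection_dual /eta scalerA -sym.
  by rewrite scalerBr addrA addrAC.
exists eta => //.
have eta0 : eta != 0.
  apply: contra_eqN rkH => /eqP eta0; suff -> : eigenspace H (-1) = 0 by rewrite mxrank0.
  apply/eqP/negPn/negP => /rowV0Pn[v /eigenspaceP vH v0].
  move: vH; rewrite HE /skew_reflection_dual eta0 scaler0 addr0 scaleN1r => /eqP.
  by rewrite -addr_eq0 -mulr2n -scaler_nat scaler_eq0 pnatr_eq0 (negbTE v0).
have : e *m H *m H = e by rewrite -mulmxA HH mulmx1.
rewrite !HE /skew_reflection_dual dotDl dotZl -sym -addrA -scalerDl => /eqP.
rewrite -subr_eq0 addrAC subrr add0r scaler_eq0 (negbTE eta0) orbF.
rewrite (_ : _ + _ = dot w e * (2 + dot eta w)); last by ring.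
by rewrite mulf_eq0 (gt_eqF e0)/= addrC addr_eq0 => /eqP.
Qed.

(** Computes the quadratic part of the final equation at a vector [a i - a0], showing that it does
    not vanish. *)
Lemma dot_rescaled (R : realType) (m k : nat) (u w : 'M[R]_(k, m)) (x y : 'M[R]_(m, k)) :
  dot w (x - y) != 0 ->
  dot ((dot u (y - x) / dot w (x - y)) *: w - u) (y - x) = - (2 * dot u (y - x)).
Proof.
move=> w0; have wN : dot w (y - x) = - dot w (x - y) by rewrite -dotNr opprB.
by rewrite dotBl dotZl wN mulrN divfK//; ring.
Qed.

(** The coordinates of [p - a0] in the basis [a i - a0] are linear forms, the rows of [invmx B];
    with them [barycentric_equation] becomes a quadratic equation for [p]. *)
Lemma quadric_of_chords (R : realType) (n : nat) (f : 'cV[R]_n -> R) (O w0 : 'cV[R]_n)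
    (eps delta : R) (Sg : set 'cV[R]_n) (nu : 'cV[R]_n -> 'rV[R]_n) :
    (0 < n)%N -> C1_submersion_near f O -> dot (dmx f O) w0 = 0 ->
    0 < delta <= `|w0| -> Sg O -> (forall p, nu p = eps *: dmx f p) ->
    (forall p, Sg p -> C1_submersion_near f p) ->
    (forall p, Sg p -> f p = f O) ->
    (forall p, Sg p -> \forall q \near p, f q = f O -> Sg q) ->
    (forall p q, Sg p -> Sg q -> q != p -> 0 < dot (nu p) (q - p)) ->
    (forall p q, Sg p -> Sg q -> cone w0 delta (q - p) \/ cone w0 delta (- (q - p)) ->
      exists2 eta, dot eta (q - p) = -2 & forall q1 q2, Sg q1 -> Sg q2 -> q2 != q1 ->
        (exists l, q2 - q1 = l *: (q - p)) ->
        exists2 c, 0 < c & nu q2 = c *: skew_reflection_dual eta (q - p) (nu q1)) ->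
  exists2 Q : set 'cV[R]_n, quadric Q & \forall p \near O, f p = f O -> Q p.
Proof.
move=> n0 C1f dw dpos SO nuE Sg_C1 Sg_level Sg_near Sg_support Sg_chord.
have dirN x : cone w0 delta x \/ cone w0 delta (- x) ->
    cone w0 delta (- x) \/ cone w0 delta (- - x).
  by rewrite opprK => -[]; [right|left].
have Sg_O := Sg_near _ SO.
have supO q : Sg q -> q != O -> 0 < dot (eps *: dmx f O) (q - O).
  by rewrite -nuE; exact: Sg_support.
have bary := barycentric_equation nuE Sg_C1 Sg_level Sg_near Sg_support dirN Sg_chord.
have [a0 [a [[Sa0 Ca0] Sa unitB]]] := spanning_chords C1f Sg_O
  supO dw dpos.
set B := \matrix_(i, j) _ in unitB.
have cone_neq x y : cone w0 delta (x - y) -> x != y.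
  apply: contraPneq => ->; rewrite subrr; apply: cone0.
  by case/andP: dpos.
have Cai i : cone w0 delta (a i - a0).
  by rewrite -(subrKA O); apply: coneD => //; have [] := Sa i.
have nA i : 0 < dot (nu a0) (a i - a0).
  by apply: Sg_support => //; [have [] := Sa i|exact: cone_neq].
pose Nu i := (dot (nu a0) (a i - a0) / dot (nu (a i)) (a0 - a i)) *: nu (a i) - nu a0.
pose D := \matrix_(i, j) Nu i 0 j.
have DN i : row i D = Nu i by apply/rowP => j; rewrite !mxE.
have dotB (x : 'cV[R]_n) i : dot (row i (invmx B)) x = (invmx B *m x) i 0.
  by rewrite dotE big_ord1 mxE; apply: eq_bigr => j _; rewrite mxE.
exists [set p : 'cV[R]_n | dot (2 *: nu a0) (p - a0) +
    \sum_i dot (row i (invmx B)) (p - a0) * dot (row i D) (p - a0) = 0].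
  pose i0 := Ordinal n0.
  apply: (@quadric_form _ _ _ _ _ _ (a i0 - a0)).
  have dB i : dot (row i (invmx B)) (a i0 - a0) = (i == i0)%:R.
    have -> : a i0 - a0 = col i0 B by apply/colP => j; rewrite !mxE.
    by rewrite dotB colE mulmxA mulVmx// mul1mx !mxE eqxx andbT.
  rewrite (bigD1 i0)//= big1 => [|i ii0]; last by rewrite dB (negbTE ii0) mul0r.
  have Aa : dot (nu (a i0)) (a0 - a i0) != 0.
    rewrite gt_eqF//; apply: Sg_support => //; first by have [] := Sa i0.
    by rewrite eq_sym; exact: cone_neq.
  rewrite addr0 dB eqxx mul1r DN (dot_rescaled _ Aa) oppr_eq0 gt_eqF//.
  by rewrite mulr_gt0.
(* The cone is open and contains [O - a0] and all [a i - O], so chords from [p] near [O] to these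
   points remain admissible. *)
have nCp : \forall p \near O, cone w0 delta (p - a0).
  have /nbhs_addP[d d0 Hd] := cone_near Ca0.
  by apply/nbhs_addP; exists d => // y yd; rewrite addrAC; exact: Hd.
have nCap : \forall p \near O, forall i, cone w0 delta (a i - p).
  have nCapi i : \forall p \near O, cone w0 delta (a i - p).
    have [_ /cone_near/nbhs_addP[d d0 Hd]] := Sa i.
    apply/nbhs_addP; exists d => // y yd; rewrite opprD addrA; apply: Hd.
    by rewrite normrN.
  exact: (@filter_forall _ _ (fun i p => cone w0 delta (a i - p)) (nbhs O) _ nCapi).
near=> p => fp.
have Sgp : Sg p by move: fp; near: p.
have Cp : cone w0 delta (p - a0) by near: p.
have Cap : forall i, cone w0 delta (a i - p) by near: p.
have pE : p - a0 = \sum_i dot (row i (invmx B)) (p - a0) *: (a i - a0).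
  rewrite -[LHS]mul1mx -(mulmxV unitB) -mulmxA; apply/colP => j; rewrite mxE summxE.
  by apply: eq_bigr => i _; rewrite dotB !mxE mulrC.
have := bary _ a0 a (fun i => dot (row i (invmx B)) (p - a0)) p Sa0 Sgp.
rewrite /= (dotZl 2 (nu a0)) => bary_p.
under eq_bigr do rewrite DN.
apply: bary_p => //.
- by move=> i; have [] := Sa i.
- exact: cone_neq.
- by move=> i; exact: cone_neq.
- by move=> i; exact: cone_neq.
- by left.
- by left.
- by move=> i; right; rewrite opprB.
Unshelve. all: by end_near.
Qed.

Theorem theorem2 (R : realType) (n : nat) (hn : (2 <= n)%N)
    (S : set 'cV[R]_n) (O_S : 'cV[R]_n) (U : set 'rV[R]_n) (O_U : 'rV[R]_n)
    (F : 'rV[R]_n -> R) (Ft : 'cV[R]_n -> R)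
    (hS : strictly_convex_C1_germ S O_S)
    (hU : strictly_convex_C1_germ U O_U)
    (hF : C1_submersion_near F O_U) (hFU : level_germ U O_U F)
    (hFt : C1_submersion_near Ft O_S) (hFtS : level_germ S O_S Ft)
    (htangent : tangent_hyperplane Ft O_S (dmx F O_U))
    (hH : exists H : 'rV[R]_n -> 'M[R]_n,
      (\forall q \near O_U, U q ->
         involution_fixing (tangent_hyperplane F q) (H q)) /\
      (exists2 W : set 'cV[R]_n, nbhs O_S W &
         \forall q \near O_U & v_in \near dmx Ft O_S, U q ->
           forall v_out : 'rV[R]_n,
             finsler_billiard (S `&` W) F Ft q v_in v_out ->
             exists2 c : R, 0 < c & v_out = c *: (v_in *m H q))) :
  exists2 Q : set 'cV[R]_n, quadric Q & \forall p \near O_S, S p -> Q p.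
Proof.
have [H [Hinv [W WO [[Q1 Q2] /= [Q1n Q2n] HQ]]]] := hH.
set w0 := dmx F O_U in htangent.
have [_ [KU [bodyU bU KUP]]] := hU; have [U0 UF] := hFU.
have [_ [KS [bodyS bS KSP]]] := hS; have [S0 SF] := hFtS.
have bKU : \forall q \near O_U, bdry KU q <-> F q = F O_U.
  near=> q.
  have h1 : U q <-> F q = F O_U by near: q.
  have h2 : U q <-> bdry KU q by near: q.
  by rewrite -h1 -h2.
have bKS : \forall q \near O_S, Ft q = Ft O_S -> bdry KS q.
  near=> q => fq.
  have h1 : S q <-> Ft q = Ft O_S by near: q.
  have h2 : S q <-> bdry KS q by near: q.
  by apply/h2/h1.
have w00 : w0 != 0 by have [] := nbhs_singleton hF.
have [eps eps0 sup] := near_strict_support bodyS hFt bKS.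
pose N q := [/\ U q <-> F q = F O_U, dmx F q != 0,
  U q -> involution_fixing (tangent_hyperplane F q) (H q) & Q1 q].
have NU : nbhs O_U N.
  near=> q; split; [by near: q| |by near: q|by near: q].
  suff [] : [/\ differentiable F q, {for q, continuous (dmx F)} & dmx F q != 0] by [].
  by near: q.
have [d1 d10 gauss] := (nbhs_addP _ _).1 (gauss_map_onto bodyU hF bKU NU).
(* The bound [d1] makes every direction of the cone proportional to [dmx F] at a point of [U]; the
   other bound keeps 0 out of the cone. *)
pose delta := Num.min d1 `|w0|.
have dpos : 0 < delta <= `|w0| by rewrite lt_min d10 normr_gt0 w00 ge_min lexx orbT.
pose G p := [/\ C1_submersion_near Ft p, S p <-> Ft p = Ft O_S,
  Ft p = Ft O_S -> bdry KS p /\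
    forall x, KS x -> x != p -> 0 < dot (eps *: dmx Ft p) (x - p),
  W p & Q2 (dmx Ft p)].
have GO : nbhs O_S G.
  have [_ cFt _] := nbhs_singleton hFt.
  have Q2near : \forall p \near O_S, Q2 (dmx Ft p) by exact: (cFt _ Q2n).
  have C1near := near_join hFt.
  near=> p; split; [by near: p|by near: p| |by near: p|by near: p].
  move=> fp; split; first by move: fp; near: p.
  suff [] : smooth_boundary_at Ft KS p /\
    forall x, KS x -> x != p -> 0 < dot (eps *: dmx Ft p) (x - p) by [].
  by move: fp; near: p.
have [r r0 Gr] := (nbhs_addP _ _).1 GO.
pose Sg p := Ft p = Ft O_S /\ `|p - O_S| < r.
have SgG p : Sg p -> G p by move=> [_ pr]; rewrite -(subrKC O_S p); apply: Gr.
pose nu p := eps *: dmx Ft p.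
pose dir x := cone w0 delta x \/ cone w0 delta (- x).
have Sg_C1 p : Sg p -> C1_submersion_near Ft p by move=> /SgG[].
have Sg_level p : Sg p -> Ft p = Ft O_S by case.
have Sg_near p : Sg p -> \forall q \near p, Ft q = Ft O_S -> Sg q.
  move=> [_ pr]; apply/nbhs_addP; exists (r - `|p - O_S|); first by rewrite subr_gt0.
  move=> x; rewrite ltrBrDl => xr fx; split=> //; rewrite addrAC.
  exact: le_lt_trans (ler_normD _ _) xr.
have Sg_support p q : Sg p -> Sg q -> q != p -> 0 < dot (nu p) (q - p).
  move=> Sp Sq qp; have [_ _ /(_ (Sg_level _ Sp))[_ H1] _ _] := SgG _ Sp.
  apply: H1 => //; have [_ _ /(_ (Sg_level _ Sq))[bq _] _ _] := SgG _ Sq.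
  exact: bdry_body bq.
have Sg_chord p q : Sg p -> Sg q -> dir (q - p) ->
    exists2 eta, dot eta (q - p) = -2 & forall q1 q2, Sg q1 -> Sg q2 -> q2 != q1 ->
      (exists l, q2 - q1 = l *: (q - p)) ->
      exists2 c, 0 < c & nu q2 = c *: skew_reflection_dual eta (q - p) (nu q1).
  move=> Sp Sq dpq.
  have [t t0 wt] : exists2 t, t != 0 & `|t *: (q - p) - w0| < delta.
    have scale x s : 0 < s -> `|x - s *: w0| < delta * s -> `|s^-1 *: x - w0| < delta.
      move=> s0 xs; rewrite -(ltr_pM2r s0) (le_lt_trans _ xs)// mulrC.
      by rewrite -{1}(gtr0_norm s0) -normrZ scalerBr scalerA divff ?gt_eqF// scale1r.
    case: dpq => -[s s0 /(scale _ _ s0) xs].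
      by exists s^-1 => //; rewrite invr_eq0 gt_eqF.
    exists (- s^-1); first by rewrite oppr_eq0 invr_eq0 gt_eqF.
    by rewrite scaleNr -scalerN.
  (* The point [q'] of [U] is the one where the billiard reflects along chords parallel to
     [q - p]. *)
  have [|q' [[Uq' dq' inv Q1q'] Fq' [c cE]]] := gauss (t *: (q - p) - w0).
    by rewrite (lt_le_trans wt)// ge_min lexx.
  rewrite subrKC in cE.
  have Uq : U q' by apply/Uq'.
  have [eta' ew etaP] := involution_fixingP dq' (inv Uq).
  have k0 : t^-1 * c != 0.
    rewrite mulf_neq0 ?invr_eq0//; apply: contraTneq wt => c0.
    by rewrite cE c0 scale0r sub0r normrN -leNgt ge_min lexx orbT.
  have {cE}kE : q - p = (t^-1 * c) *: dmx F q'.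
    by rewrite -scalerA -cE scalerA mulVf// scale1r.
  (* Scaling [eta'] inversely to the direction leaves the reflection unchanged. *)
  have dualE mu : skew_reflection_dual ((t^-1 * c)^-1 *: eta') (q - p) mu = mu *m H q'.
    rewrite etaP /skew_reflection_dual kE dotZr scalerA mulrAC.
    by rewrite mulfV// mul1r.
  exists ((t^-1 * c)^-1 *: eta'); first by rewrite kE dotZl dotZr ew mulKf.
  move=> q1 q2 Sq1 Sq2 q12 [l lE].
  have [_ S1 _ W1 V1] := SgG _ Sq1; have [_ S2 _ W2 _] := SgG _ Sq2.
  (* The ray arriving with velocity [dmx Ft q1] leaves with [dmx Ft q2], the chord being
     transversal. Linearity of [H q'] transfers the relation to [nu] whatever the sign of [eps]. *)
  have [|c' c'0 c'E] := HQ (q', dmx Ft q1) (conj Q1q' V1) Uq (dmx Ft q2).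
    exists q1; split; first by split=> //; apply/S1/Sg_level.
      by exists 1; rewrite ?scale1r.
    left; exists q2; split=> //; first by split=> //; apply/S2/Sg_level.
    by exists (l * (t^-1 * c)); rewrite -scalerA -kE -lE subrKC.
  by exists c'; rewrite // dualE /nu c'E -scalemxAl scalerA mulrC -scalerA.
have dw : dot (dmx Ft O_S) w0 = 0 by rewrite -diff_dot.
have SO : Sg O_S by split=> //; rewrite subrr normr0.
have [Q qQ nQ] := quadric_of_chords (ltnW hn) hFt dw dpos SO (fun=> erefl) Sg_C1 Sg_level
  Sg_near Sg_support Sg_chord.
exists Q => //; near=> p => Sp.
have SFp : S p <-> Ft p = Ft O_S by near: p.
by move/SFp: Sp; near: p.
Unshelve. all: by end_near.
Qed.
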